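(* In the setting described in the context, suppose Method 1 does not stop, and let $(x^k)_{k\in\mathbb N}$ be the generated sequence. Then every weak accumulation point of $(x^k)_{k\in\mathbb N}$ belongs to $\operatorname{zer}(A+B)$.
   Context: Let $\mathcal H$ be a real Hilbert space with inner product $\langle\cdot,\cdot\rangle$ and norm $\|\cdot\|$. Let $A_1:\mathcal H\to\mathcal H$ be $\beta$-cocoercive for some $\beta>0$ (i.e. $\langle A_1x-A_1y,x-y\rangle\ge\beta\|A_1x-A_1y\|^2$ for all $x,y$), let $A_2:\mathcal H\to\mathcal H$ be maximally monotone and uniformly continuous, let $B:\mathcal H\rightrightarrows\mathcal H$ be maximally monotone, and set $A:=A_1+A_2$. Assume $\operatorname{zer}(A+B):=\{x:0\in Ax+Bx\}\neq\emptyset$. $J_{\alpha B}:=(I+\alpha B)^{-1}$ for $\alpha>0$, and $P_C$ denotes the orthogonal projection onto a nonempty closed convex set $C$. Fix $\theta,\delta\in(0,1)$, $\bar\delta>0$ with $1-\delta-\bar\delta>0$, and $\alpha_{-1}>0$ with $\alpha_{-1}\le4\beta\bar\delta$. Conceptual Algorithm: pick $x^0\in\mathcal H$. Given $x^k$ and $\alpha_{k-1}$, for $j\in\mathbb N$ let $\bar x^k_j:=J_{\alpha_{k-1}\theta^jB}(x^k-\alpha_{k-1}\theta^jAx^k)$ and let $j(k)$ be the smallest $j\in\mathbb N$ with $\alpha_{k-1}\theta^j\langle A_2x^k-A_2\bar x^k_j,x^k-\bar x^k_j\rangle\le\delta\|x^k-\bar x^k_j\|^2$. Set $\alpha_k:=\alpha_{k-1}\theta^{j(k)}$,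 $\bar x^k:=J_{\alpha_kB}(x^k-\alpha_kAx^k)$, $r_k:=\frac{\bar\delta}{\alpha_k}\|x^k-\bar x^k\|^2$ and $T_k:=\{x\in\mathcal H:\langle \frac{x^k-\bar x^k}{\alpha_k}-(A_2x^k-A_2\bar x^k),x-\bar x^k\rangle\le r_k\}$. Method 1 sets $x^{k+1}:=P_{T_k}(x^k)$ and stops if $x^{k+1}=x^k$. *)

(* Defs.v *)
From HB Require Import structures.
From mathcomp Require Import all_boot all_order all_algebra.
From mathcomp Require Import all_classical all_reals all_analysis.
Set Implicit Arguments. Unset Strict Implicit. Unset Printing Implicit Defensive.
Import Order.TTheory GRing.Theory Num.Theory.
Import numFieldNormedType.Exports.
Local Open Scope classical_set_scope.
Local Open Scope ring_scope.

Section Hilbert.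
Variables (R : realType) (H : completeNormedModType R).

Definition is_inner_product (ip : H -> H -> R) : Prop :=
  (forall x y, ip x y = ip y x) /\
  (forall (a : R) x y z, ip (a *: x + y) z = a * ip x z + ip y z) /\
  (forall x, ip x x = `|x| ^+ 2).

Definition monotone_op (ip : H -> H -> R) (B : H -> set H) : Prop :=
  forall x y u v, B x u -> B y v -> 0 <= ip (x - y) (u - v).

Definition maximally_monotone (ip : H -> H -> R) (B : H -> set H) : Prop :=
  monotone_op ip B /\
  forall x u, (forall y v, B y v -> 0 <= ip (x - y) (u - v)) -> B x u.

Definition single_op (A : H -> H) : H -> set H := fun x => [set A x].

Definition cocoercive (ip : H -> H -> R) (beta : R) (A : H -> H) : Prop :=
  forall x y, beta * `|A x - A y| ^+ 2 <= ip (A x - A y) (x - y).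

Definition unif_cont_op (A : H -> H) : Prop :=
  forall e : R, 0 < e -> exists2 d : R, 0 < d &
    forall x y, `|x - y| < d -> `|A x - A y| < e.

Definition zer_sum (A : H -> H) (B : H -> set H) : set H :=
  [set x | exists2 u, B x u & A x + u = 0].

(* resolvent J_{alpha B} z = (I + alpha B)^{-1} z : the point p with
   z - p in alpha B p (single-valued for maximally monotone B, alpha > 0) *)
Definition resolvent (B : H -> set H) (alpha : R) (z : H) : H :=
  xget 0 [set p | exists2 u, B p u & z = p + alpha *: u].

Definition is_proj (C : set H) (x p : H) : Prop :=
  C p /\ forall y, C y -> `|x - p| <= `|x - y|.

Definition proj_onto (C : set H) (x : H) : H := xget 0 [set p | is_proj C x p].

Definition weak_cluster (ip : H -> H -> R) (u : nat -> H) (z : H) : Prop :=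
  exists phi : nat -> nat, (forall n, (phi n < phi n.+1)%N) /\
    forall y, (fun n => ip (u (phi n)) y) @ \oo --> ip z y.

End Hilbert.

(* Main.v *)
(* Write v_k for the normal vector of T_k, so that x^{k+1} = x^k - lambda_k v_k.
   Fejer monotonicity gives x^k - xbar^k -> 0. Up to vanishing errors v_k lies in
   (A + B)(xbar^k), so everything would follow from v_k -> 0. This is clear when
   alpha_k stays away from 0. When alpha_k -> 0, the failed test of the line
   search yields v_k -> 0 along the indices k with j(k) > 0 only, and since the
   step is never reset, a weakly convergent subsequence may avoid these indices.

   Between two backtracking indices alpha_k is constant, and the method is an
   explicit discretisation of x' in -(A + B)x. As for the flow, whose speed is
   nonincreasing, a doubling-of-variables argument shows that |x^k - x^m|^2 is at
   most C eta^2 (t_k - t_m)^2 + o(1), with t_k the sum of the lambda_i, on every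
   run that starts right after an index with |v_s| < eta. The errors are
   controlled by the tail of the sum of |x^{k+1} - x^k|^2 and do not accumulate
   with the length of the run. Hence the iterates move by O(eta) in unit time,
   which gives limsup <w, x^k - y> <= 0 for each w in (A + B)y along the whole
   sequence. *)
Require Import Defs.
From HB Require Import structures.
From mathcomp Require Import all_boot all_order all_algebra.
From mathcomp Require Import all_classical all_reals all_analysis.
From mathcomp Require Import ring lra.
Import Order.TTheory GRing.Theory Num.Theory.
Import numFieldNormedType.Exports.
Local Open Scope classical_set_scope.
Local Open Scope ring_scope.

Set Implicit Arguments.
Unset Strict Implicit.
Unset Printing Implicit Defensive.

(** * Inner products and Minty's theorem *)

Section InnerProduct.
Variables (R : realType) (H : completeNormedModType R) (ip : H -> H -> R).
Hypothesis ip_inner : is_inner_product ip.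

Lemma ipC x y : ip x y = ip y x. Proof. by case: ip_inner. Qed.

Lemma ipxx x : ip x x = `|x| ^+ 2. Proof. by case: ip_inner => _ []. Qed.

Lemma ipDl x y z : ip (x + y) z = ip x z + ip y z.
Proof. by case: ip_inner => _ [/(_ 1 x y z)]; rewrite scale1r mul1r. Qed.

Lemma ip0l z : ip 0 z = 0.
Proof. by apply: (@addIr _ (ip 0 z)); rewrite -ipDl !add0r. Qed.

Lemma ipZl (c : R) x z : ip (c *: x) z = c * ip x z.
Proof. by case: ip_inner => _ [/(_ c x 0 z)]; rewrite addr0 ip0l addr0. Qed.

Lemma ipNl x z : ip (- x) z = - ip x z.
Proof. by rewrite -scaleN1r ipZl mulN1r. Qed.

Lemma ipDr x y z : ip z (x + y) = ip z x + ip z y.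
Proof. by rewrite !(ipC z) ipDl. Qed.

Lemma ip0r z : ip z 0 = 0. Proof. by rewrite ipC ip0l. Qed.

Lemma ipZr (c : R) x z : ip z (c *: x) = c * ip z x.
Proof. by rewrite !(ipC z) ipZl. Qed.

Lemma ipNr x z : ip z (- x) = - ip z x.
Proof. by rewrite !(ipC z) ipNl. Qed.

Definition ip_expand := (ipDl, ipDr, ipNl, ipNr, ipZl, ipZr).

Lemma le_ip_norm x y : ip x y <= `|x| * `|y|.
Proof.
have [->|x0] := eqVneq x 0; first by rewrite ip0l normr0 mul0r.
have [->|y0] := eqVneq y 0; first by rewrite ip0r normr0 mulr0.
have xy0 : 0 < `|x| * `|y| by rewrite mulr_gt0 ?normr_gt0.
have := sqr_ge0 `| `|y| *: x - `|x| *: y|.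
rewrite -ipxx !ip_expand !ipxx (ipC y x) => h.
rewrite -(ler_pM2l xy0); lra.
Qed.

Lemma ler_normr_ip x y : `|ip x y| <= `|x| * `|y|.
Proof.
rewrite ler_norml le_ip_norm andbT.
by have := le_ip_norm (- x) y; rewrite ipNl normrN lerNl.
Qed.

Lemma cvg_ipl (u : nat -> H) l z : u @ \oo --> l ->
  (fun n => ip (u n) z) @ \oo --> ip l z.
Proof.
move=> ul; apply/cvgrPdist_lt => e e0.
have z0 : 0 < `|z| + 1 by rewrite ltr_pwDr.
have /cvgrPdist_lt/(_ (e / (`|z| + 1)) (divr_gt0 e0 z0)) := ul.
apply: filterS => n; rewrite ltr_pdivlMr// => h.
rewrite -ipNl -ipDl; apply: le_lt_trans (ler_normr_ip _ _) _.
by apply: le_lt_trans h; rewrite ler_wpM2l ?lerDl.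
Qed.

Lemma cvg_ipr (u : nat -> H) l z : u @ \oo --> l ->
  (fun n => ip z (u n)) @ \oo --> ip z l.
Proof.
move=> ul; rewrite ipC; under eq_fun do rewrite ipC; exact: cvg_ipl.
Qed.

(* Minty's theorem without weak compactness: a minimiser of the Fitzpatrick
   function plus half the squared norm exists because minimising sequences are
   Cauchy, and maximality turns its optimality condition into a zero of
   [Id + B]. The function takes the value +oo, hence the use of its epigraph. *)
Section Fitzpatrick.
Variable B : H -> set H.
Hypothesis maxB : maximally_monotone ip B.

Definition fitzpatrick_epi (x u : H) (t : R) :=
  forall y v, B y v -> ip x v + ip y u - ip y v <= t.

Lemma fitzpatrick_epi_graph y v : B y v -> fitzpatrick_epi y v (ip y v).
Proof.
move=> Byv p q Bpq; case: maxB => mono _.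
have := mono _ _ _ _ Byv Bpq; rewrite !ip_expand; lra.
Qed.

(** If [t < ip x u], then [(x, u)] is monotonically related to the whole graph, hence lies in it by
    maximality, and testing the epigraph inequality at [(x, u)] itself is a contradiction. *)
Lemma fitzpatrick_epi_ge x u t : fitzpatrick_epi x u t -> ip x u <= t.
Proof.
move=> Ext; rewrite leNgt; apply/negP => txu.
have Bxu : B x u.
  apply: maxB.2 => y v Byv; have := Ext _ _ Byv.
  by rewrite !ip_expand; lra.
by have := Ext _ _ Bxu; lra.
Qed.

Lemma maximally_monotone_nonempty : exists y v, B y v.
Proof.
have [//|/forallNP nB] := pselect (exists y v, B y v).
exists 0, 0; apply: maxB.2 => y v Byv; case: (nB y); by exists v.
Qed.

Let energy (x u : H) (t : R) : R := t + (`|x| ^+ 2 + `|u| ^+ 2) / 2.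

Lemma cauchy_sqr_cvg (u : nat -> H) :
  (forall n m, `|u n - u m| ^+ 2 <= 4 * (n.+1%:R^-1 + m.+1%:R^-1)) ->
  cvg (u @ \oo).
Proof.
move=> hu; apply: cauchy_cvg; apply: cauchy_exP => e e0.
have e2 : 0 < e ^+ 2 / 8 by rewrite divr_gt0// exprn_gt0.
have [N hN] : exists N : nat, N.+1%:R^-1 < e ^+ 2 / 8.
  exists (Num.truncn (e ^+ 2 / 8)^-1).
  by rewrite invf_plt ?posrE// truncnS_gt.
exists (u N); exists N => // n /= Nn.
rewrite -ball_normE /=; rewrite -(@ltr_pXn2r _ 2)// ?nnegrE ?(ltW e0)//.
apply: le_lt_trans (hu _ _) _.
have : n.+1%:R^-1 <= N.+1%:R^-1 :> R by rewrite lef_pV2 ?posrE// ler_nat ltnS.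
by move: hN; set p := N.+1%:R^-1; set q := n.+1%:R^-1 => *; lra.
Qed.

Lemma fitzpatrick_minimizer : exists x u t, fitzpatrick_epi x u t /\
  forall x' u' t', fitzpatrick_epi x' u' t' -> energy x u t <= energy x' u' t'.
Proof.
pose V := [set r | exists x u t, fitzpatrick_epi x u t /\ r = energy x u t].
have V0 : V !=set0.
  have [y [v Byv]] := maximally_monotone_nonempty.
  exists (energy y v (ip y v)), y, v, (ip y v); split => //.
  exact: fitzpatrick_epi_graph.
have Vlb : lbound V 0.
  move=> _ [x [u [t [Ext ->]]]]; have := fitzpatrick_epi_ge Ext.
  have := sqr_ge0 `|x + u|; rewrite /energy -!ipxx !ip_expand (ipC u x); lra.
have hV : has_inf V by split => //; exists 0.
pose m := inf V.
have mle x u t : fitzpatrick_epi x u t -> m <= energy x u t.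
  by move=> Ext; apply: ge_inf; [exists 0|exists x, u, t].
have /choice[w hw] : forall n : nat, exists w : H * H * R,
    fitzpatrick_epi w.1.1 w.1.2 w.2 /\ energy w.1.1 w.1.2 w.2 < m + n.+1%:R^-1.
  move=> n; have [//|_ [x [u [t [Ext ->]]]] lt] := @inf_adherent _ V n.+1%:R^-1 _ hV.
  by exists (x, u, t).
pose X n := (w n).1.1; pose U n := (w n).1.2; pose T n := (w n).2.
have cauchyXU n k : `|X n - X k| ^+ 2 + `|U n - U k| ^+ 2 <=
    4 * (n.+1%:R^-1 + k.+1%:R^-1).
  have [En ln] := hw n; have [Ek lk] := hw k.
  (* The epigraph is convex, so the midpoint has energy at least [m]; the parallelogram identity
     then makes the minimising sequence Cauchy. *)
  have Emid : fitzpatrick_epi (2^-1 *: (X n + X k)) (2^-1 *: (U n + U k))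
      ((T n + T k) / 2).
    move=> y v Byv; have := En _ _ Byv; have := Ek _ _ Byv.
    rewrite /X /U /T !ip_expand; lra.
  have := mle _ _ _ Emid; move: ln lk.
  rewrite /energy -/(X n) -/(U n) -/(T n) -/(X k) -/(U k) -/(T k).
  rewrite -!ipxx !ip_expand (ipC (X k) (X n)) (ipC (U k) (U n)).
  by set p := n.+1%:R^-1; set q := k.+1%:R^-1 => *; lra.
have /cauchy_sqr_cvg/cvg_ex[x Xx] : forall n k,
    `|X n - X k| ^+ 2 <= 4 * (n.+1%:R^-1 + k.+1%:R^-1).
  by move=> n k; apply: le_trans (cauchyXU n k); rewrite lerDl sqr_ge0.
have /cauchy_sqr_cvg/cvg_ex[u Uu] : forall n k,
    `|U n - U k| ^+ 2 <= 4 * (n.+1%:R^-1 + k.+1%:R^-1).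
  by move=> n k; apply: le_trans (cauchyXU n k); rewrite lerDr sqr_ge0.
(* This height gives the limit point energy exactly [m]. Membership in the epigraph follows by
   passing to the limit in each of its inequalities. *)
exists x, u, (m - (`|x| ^+ 2 + `|u| ^+ 2) / 2); split; last first.
  by move=> x' u' t' /mle; rewrite /energy; lra.
move=> y v Byv.
have cvL : (fun n => ip (X n) v + ip y (U n) - ip y v) @ \oo -->
    ip x v + ip y u - ip y v.
  apply: cvgB; last exact: cvg_cst.
  by apply: cvgD; [exact: cvg_ipl|exact: cvg_ipr].
have cvR : (fun n => (m + n.+1%:R^-1) -
      (`|X n| * `|X n| + `|U n| * `|U n|) * 2^-1) @ \oo -->
    (m + 0) - (`|x| * `|x| + `|u| * `|u|) * 2^-1.
  apply: cvgB.
    by apply: cvgD; [exact: cvg_cst|exact: cvg_harmonic].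
  apply: cvgMl; apply: cvgD; apply: cvgM; exact: cvg_norm.
rewrite !expr2 -[m in leRHS]addr0; apply: ler_cvg_to cvL cvR _.
apply: nearW => n; have [En ln] := hw n.
have := En _ _ Byv; move: ln; rewrite /energy -/(X n) -/(U n) -/(T n) !expr2.
by set p := n.+1%:R^-1 => *; lra.
Qed.

(** Optimality along segments from the minimiser to graph points makes [(- u, - x)] monotonically
    related to the graph, hence a member of it. Optimality at that very point gives
    [|x + u| ^+ 2 <= 0]. *)
Lemma fitzpatrick_zero : exists x, B x (- x).
Proof.
have [x [u [t [Ext min]]]] := fitzpatrick_minimizer.
have opt y v : B y v -> 0 <= ip y v - t + ip x (y - x) + ip u (v - u).
  move=> Byv; rewrite leNgt; apply/negP => neg.
  set K := ip y v - t + ip x (y - x) + ip u (v - u) in neg.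
  pose q := `|y - x| ^+ 2 + `|v - u| ^+ 2.
  have q0 : 0 <= q by rewrite addr_ge0 ?sqr_ge0.
  (* This [s] lies in [(0, 1]] and satisfies [s * q <= - K], so the linear decrease [s * K] beats
     the quadratic term [s ^+ 2 * q / 2]. *)
  pose s := - K / (q + - K).
  have qK : 0 < q + - K by lra.
  have s0 : 0 < s by rewrite divr_gt0// oppr_gt0.
  have s1 : s <= 1 by rewrite ler_pdivrMr// mul1r; lra.
  have Eyv := fitzpatrick_epi_graph Byv.
  have Es : fitzpatrick_epi (x + s *: (y - x)) (u + s *: (v - u))
      (t + s * (ip y v - t)).
    move=> p r Bpr; have h1 := Ext _ _ Bpr; have h2 := Eyv _ _ Bpr.
    rewrite !ip_expand; nra.
  have := min _ _ _ Es.
  have -> : energy (x + s *: (y - x)) (u + s *: (v - u)) (t + s * (ip y v - t)) =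
      energy x u t + s * (K + s * q / 2).
    by rewrite /energy /K /q -!ipxx !ip_expand (ipC y x) (ipC v u); field.
  have : s * (K + s * q / 2) < 0.
    rewrite pmulr_rlt0//.
    have : s * q <= - K.
      by rewrite /s mulrAC ler_pdivrMr// ler_pM2l ?oppr_gt0// lerDl; lra.
    by lra.
  by lra.
have txu := fitzpatrick_epi_ge Ext.
have Bux : B (- u) (- x).
  apply: (proj2 maxB) => p r Bpr; have := opt _ _ Bpr; have := sqr_ge0 `|x + u|.
  by rewrite -ipxx !ip_expand (ipC u x) (ipC p x); lra.
have := opt _ _ Bux; rewrite !ip_expand (ipC u x) => h.
have : `|x + u| ^+ 2 <= 0 by rewrite -ipxx !ip_expand (ipC u x); lra.
rewrite exprn_even_le0//= normr_eq0 addrC addr_eq0 => /eqP ux.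
by exists x; move: Bux; rewrite ux opprK.
Qed.

End Fitzpatrick.
End InnerProduct.

(** * Monotone and cocoercive operators *)

Section Operators.
Variables (R : realType) (H : completeNormedModType R) (ip : H -> H -> R).
Hypothesis ip_inner : is_inner_product ip.

Let ipE := ip_expand ip_inner.

Lemma resolventP (B : H -> set H) (alpha : R) z :
  maximally_monotone ip B -> 0 < alpha ->
  B (resolvent B alpha z) (alpha^-1 *: (z - resolvent B alpha z)).
Proof.
move=> [mono max] a0.
(* [B'] is again maximally monotone, and a zero [p] of [Id + B'] satisfies
   [B p (alpha^-1 *: (z - p))]. *)
pose B' : H -> set H := fun p => [set w | B p (alpha^-1 *: (w + z))].
have [p Bp] : exists p, B' p (- p).
  apply: (@fitzpatrick_zero _ _ ip) => //; split=> [x y u v Bxu Byv|x u h].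
    have := mono _ _ _ _ Bxu Byv.
    by rewrite -scalerBr opprD addrACA subrr addr0 (ipZr ip_inner) pmulr_rge0// invr_gt0.
  apply: max => y v Byv.
  have := h y (alpha *: v - z); rewrite /B' /= subrK scalerA mulVf ?gt_eqF//.
  rewrite scale1r => /(_ Byv).
  rewrite (_ : u - (alpha *: v - z) = alpha *: (alpha^-1 *: (u + z) - v)).
    by rewrite (ipZr ip_inner) pmulr_rge0.
  by rewrite scalerBr scalerA divff ?gt_eqF// scale1r opprB addrA addrAC.
have /(xgetPex 0) : exists q, [set q | exists2 u, B q u & z = q + alpha *: u] q.
  exists p, (alpha^-1 *: (- p + z)) => //.
  by rewrite scalerA divff ?gt_eqF// scale1r addrA subrr add0r.
rewrite -/(resolvent B alpha z); move: (resolvent B alpha z) => r [w Brw ->].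
by rewrite addrAC subrr add0r scalerA mulVf ?gt_eqF// scale1r.
Qed.

Lemma resolvent_forward (B : H -> set H) (t : R) p g :
  maximally_monotone ip B -> 0 < t ->
  B (resolvent B t (p - t *: g)) (t^-1 *: (p - resolvent B t (p - t *: g)) - g).
Proof.
move=> maxB t0; have := resolventP (p - t *: g) maxB t0.
move: (resolvent _ _ _) => q; rewrite addrAC scalerBr [in X in X -> _]scalerA.
by rewrite mulVf ?gt_eqF// scale1r.
Qed.

(** For the displacements [d], [d'] with steps [s], [t], monotonicity of [B] and Cauchy-Schwarz give
    [(|d| - |d'|) * (s^-1 * |d| - t^-1 * |d'|) <= 0]. Both factors would be positive if
    [|d'| < |d|]. *)
Lemma resolvent_displacement_le (B : H -> set H) (s t : R) p g :
  maximally_monotone ip B -> 0 < s -> s <= t ->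
  `|p - resolvent B s (p - s *: g)| <= `|p - resolvent B t (p - t *: g)|.
Proof.
move=> maxB s0 st; have t0 := lt_le_trans s0 st.
have := (proj1 maxB) _ _ _ _ (resolvent_forward p g maxB s0)
  (resolvent_forward p g maxB t0).
move: (resolvent B s _) (resolvent B t _) => q q'.
have -> : q - q' = (p - q') - (p - q).
  by rewrite opprB [RHS]addrC subrKA.
rewrite (opprB (_ *: _) g) subrKA; move: (p - q) (p - q') => d d' h.
have {}h : s^-1 * `|d| ^+ 2 + t^-1 * `|d'| ^+ 2 <= (s^-1 + t^-1) * (`|d| * `|d'|).
  have si : 0 <= s^-1 + t^-1 by rewrite addr_ge0// invr_ge0 ltW.
  have := ler_wpM2l si (le_ip_norm ip_inner d d').
  by move: h; rewrite !ipE !(ipxx ip_inner) (ipC ip_inner d' d); lra.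
rewrite leNgt; apply/negP => dd.
have d0 : 0 < `|d| := le_lt_trans (normr_ge0 _) dd.
have ti : t^-1 <= s^-1 by rewrite lef_pV2.
have si : 0 < s^-1 by rewrite invr_gt0.
have : 0 < (`|d| - `|d'|) * (s^-1 * `|d| - t^-1 * `|d'|).
  rewrite mulr_gt0 ?subr_gt0//; apply: (@le_lt_trans _ _ (s^-1 * `|d'|)).
    by rewrite ler_wpM2r.
  by rewrite ltr_pM2l.
lra.
Qed.

(** Cut the segment from [x] to [y] into pieces shorter than [d]; each contributes at most [1]. *)
Lemma unif_cont_growth (A : H -> H) : unif_cont_op A ->
  exists2 L : R, 0 < L & forall x y, `|A x - A y| <= L * `|x - y| + 1.
Proof.
move=> /(_ 1 ltr01)[d d0 Ad].
have chain n x y : `|x - y| < n.+1%:R * d -> `|A x - A y| <= n.+1%:R.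
  elim: n y => [|n IH] y xy; first by apply/ltW/Ad; rewrite mul1r in xy.
  pose s : R := n.+1%:R / n.+2%:R.
  have s0 : 0 <= s by rewrite divr_ge0.
  have s1 : 1 - s = n.+2%:R^-1.
    rewrite /s -[n.+2%:R]natr1; set q := n.+1%:R.
    have q0 : 0 < q by rewrite ltr0n.
    by field; rewrite gt_eqF//; lra.
  pose w := x + s *: (y - x).
  have xw : `|x - w| < n.+1%:R * d.
    rewrite /w opprD addrA subrr add0r normrN normrZ ger0_norm// distrC /s.
    by rewrite mulrAC ltr_pdivrMr ?ltr0n// -mulrA ltr_pM2l ?ltr0n// mulrC.
  have wy : `|w - y| < d.
    have -> : w - y = (1 - s) *: (x - y).
      by rewrite scalerBl scale1r /w -(opprB x y) scalerN addrAC.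
    rewrite s1 normrZ ger0_norm ?invr_ge0// mulrC.
    by rewrite ltr_pdivrMr ?ltr0n// mulrC.
  rewrite -(subrKA (A w)); apply: le_trans (ler_normD _ _) _.
  rewrite -[n.+2]addn1 natrD; apply: lerD; first exact: IH.
  exact/ltW/Ad.
exists d^-1; first by rewrite invr_gt0.
move=> x y; pose n := Num.truncn (`|x - y| / d).
apply: le_trans (chain n x y _) _.
  by rewrite -ltr_pdivrMr// truncnS_gt.
rewrite -natr1 lerD2r mulrC truncn_le// divr_ge0//; exact: ltW.
Qed.

Lemma cocoercive_lipschitz (beta : R) (A : H -> H) : 0 < beta ->
  cocoercive ip beta A -> forall x y, `|A x - A y| <= beta^-1 * `|x - y|.
Proof.
move=> b0 coco x y; rewrite mulrC ler_pdivlMr//.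
have [->|Axy0] := eqVneq (A x) (A y); first by rewrite subrr normr0 mul0r.
have N0 : 0 < `|A x - A y| by rewrite normr_gt0 subr_eq0.
rewrite -(ler_pM2l N0); have := le_trans (coco x y) (le_ip_norm ip_inner _ _).
by rewrite expr2; lra.
Qed.

(* Completing the square in [A x - A y]: the defect [x - p - (y - q)] only
   enters quadratically. *)
Lemma cocoercive_shift (beta : R) (A : H -> H) : 0 < beta -> cocoercive ip beta A ->
  forall x y p q, - `|(x - p) - (y - q)| ^+ 2 / (4 * beta)
                  <= ip (A x - A y) (p - q).
Proof.
move=> b0 coco x y p q; move: (coco x y); move: (A x - A y) => g.
have -> : ip g (p - q) = ip g (x - y) - ip g ((x - p) - (y - q)).
  by rewrite !ipE; ring.
move: (x - y) ((x - p) - (y - q)) => e d gxy.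
rewrite ler_pdivrMr ?mulr_gt0//.
have := sqr_ge0 `|d - (2 * beta) *: g|.
move: gxy; rewrite -!(ipxx ip_inner) !ipE (ipC ip_inner d g); nra.
Qed.

(** The inequality is tested at [p t], the forward-backward image of [z] with step [t], and yields
    [|z - p t| <= t * |A z - A (p t)|]. As [t] tends to [0], the graph points
    [(p t, t^-1 *: (z - p t) - A z)] of [B] approach [(z, - A z)], which belongs to [B] by
    maximality. *)
Lemma zer_sum_of_variational (A : H -> H) (B : H -> set H) z :
  maximally_monotone ip B -> unif_cont_op A ->
  (forall y u, B y u -> ip (A y + u) (z - y) <= 0) -> zer_sum A B z.
Proof.
move=> maxB ucA var; have [L L0 growth] := unif_cont_growth ucA.
pose p t := resolvent B t (z - t *: A z).
have Bp (t : R) : 0 < t -> B (p t) (t^-1 *: (z - p t) - A z).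
  exact: resolvent_forward.
have step (t : R) : 0 < t -> `|z - p t| <= t * `|A z - A (p t)|.
  move=> t0; have := var _ _ (Bp t t0).
  have -> : A (p t) + (t^-1 *: (z - p t) - A z) =
      t^-1 *: (z - p t) - (A z - A (p t)).
    by rewrite opprB addrCA.
  rewrite (ipDl ip_inner) (ipNl ip_inner) (ipZl ip_inner) (ipxx ip_inner).
  rewrite subr_le0 => h.
  have {h} := le_trans h (le_ip_norm ip_inner _ _).
  have [->|zp] := eqVneq (z - p t) 0.
    by rewrite normr0 => _; rewrite mulr_ge0// ltW.
  have N0 : 0 < `|z - p t| by rewrite normr_gt0.
  by rewrite expr2 mulrA ler_pM2r// mulrC ler_pdivrMr// mulrC.
have small (e : R) : 0 < e -> exists t, [/\ 0 < t, `|z - p t| < e &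
    `|t^-1 *: (z - p t)| < e].
  move=> e0; have [d d0 Ad] := ucA e e0.
  pose m := Num.min d e; have m0 : 0 < m by rewrite lt_min d0.
  (* Chosen so that [m * (1 - t * L) = 2 * t], whereas affine growth gives [n * (1 - t * L) <= t]
     for [n = |z - p t|]. *)
  pose t := m / (m * L + 2).
  have mL : 0 < m * L by rewrite mulr_gt0.
  have K0 : 0 < m * L + 2 by lra.
  have t0 : 0 < t by rewrite divr_gt0.
  have zpt : `|z - p t| < m.
    have h := le_trans (step _ t0) (ler_wpM2l (ltW t0) (growth z (p t))).
    have := normr_ge0 (z - p t); set n := `|z - p t| in h * => n0.
    have tK : t * (m * L + 2) = m by rewrite divfK// gt_eqF.
    have tL : t * L * m < m by nra.
    have tL1 : t * L < 1 by rewrite -(ltr_pM2r m0) mul1r.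
    rewrite ltNge; apply/negP => mn; nra.
  exists t; split=> //; first by apply: lt_le_trans zpt _; rewrite ge_min lexx orbT.
  rewrite normrZ gtr0_norm ?invr_gt0// mulrC ltr_pdivrMr//.
  apply: le_lt_trans (step _ t0) _; rewrite mulrC ltr_pM2r//; apply: Ad.
  by apply: lt_le_trans zpt _; rewrite ge_min lexx.
exists (- A z); last by rewrite subrr.
apply: (proj2 maxB) => y v Byv; rewrite leNgt; apply/negP => neg.
set N := ip _ _ in neg.
pose C := `|A z| + `|v| + `|z - y| + 1.
have C1 : 1 <= C by rewrite lerDr !addr_ge0.
(* The three error terms below add up to at most [e * C], that is, to at most half of [- N]. *)
pose e := Num.min 1 (- N / (2 * C)).
have e0 : 0 < e by rewrite lt_min ltr01 divr_gt0 ?oppr_gt0//; lra.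
have [t [t0 ze we]] := small e e0.
set w := _ *: _ in we.
have := (proj1 maxB) _ _ _ _ (Bp t t0) Byv; rewrite -/w => h; clearbody w.
have h1 : ip (z - p t) (- A z - v) >= - (`|z - p t| * `|- A z - v|).
  by have := ler_normr_ip ip_inner (z - p t) (- A z - v); rewrite ler_norml => /andP[].
have h2 : ip w (z - y) <= `|w| * `|z - y| by exact: le_ip_norm.
have h3 : ip w (z - p t) >= - (`|w| * `|z - p t|).
  by have := ler_normr_ip ip_inner w (z - p t); rewrite ler_norml => /andP[].
have h4 : `|- A z - v| <= `|A z| + `|v|.
  by apply: le_trans (ler_normB _ _) _; rewrite normrN.
have e1 : e <= 1 by rewrite ge_min lexx.
have eN : e * (2 * C) <= - N.
  by rewrite -ler_pdivlMr ?ge_min ?lexx ?orbT//; lra.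
have NE : N = ip (p t - y) (w - A z - v) + ip (z - p t) (- A z - v)
    - ip w (z - y) + ip w (z - p t).
  by rewrite /N !ipE !(ipC ip_inner w); ring.
have b1 : `|z - p t| * `|- A z - v| <= e * (`|A z| + `|v|).
  by apply: ler_pM => //; exact: ltW.
have b2 : `|w| * `|z - y| <= e * `|z - y| by rewrite ler_wpM2r// ltW.
have b3 : `|w| * `|z - p t| <= e * 1.
  by apply: ler_pM => //; [exact: ltW|apply/ltW/(lt_le_trans ze)].
have : e * (`|A z| + `|v|) + e * `|z - y| + e * 1 = e * C by rewrite /C; ring.
lra.
Qed.

(* The test with step [t] fails, so the displacement is small compared to [t];
   the displacement for the shorter step [t * theta] is smaller still. *)
Lemma backtracking_displacement (A : H -> H) (B : H -> set H)
    (theta delta eta : R) :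
  unif_cont_op A -> maximally_monotone ip B -> 0 < theta < 1 -> 0 < delta ->
  0 < eta -> exists2 r : R, 0 < r & forall p g (t : R), 0 < t < r ->
    let q := resolvent B t (p - t *: g) in
    delta * `|p - q| ^+ 2 < t * ip (A p - A q) (p - q) ->
    `|p - resolvent B (t * theta) (p - (t * theta) *: g)| < eta * (t * theta).
Proof.
move=> ucA maxB /andP[th0 th1] de0 eta0; have [L L0 growth] := unif_cont_growth ucA.
have [d d0 Ad] := ucA _ (mulr_gt0 de0 (mulr_gt0 th0 eta0)).
(* The first bound absorbs the linear part of the growth of [A] into half of [delta * n]; the second
   then gives [n < d], so uniform continuity applies. *)
exists (Num.min (delta / (2 * L)) (delta * d / 2)).
  by rewrite lt_min !divr_gt0 ?mulr_gt0.
move=> p g t /andP[t0]; rewrite lt_min => /andP[t1 t2] q test.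
apply: (@le_lt_trans _ _ `|p - q|).
  by apply: resolvent_displacement_le => //; rewrite ?mulr_gt0// ger_pMr// ltW.
have {test} test := lt_le_trans test
  (ler_wpM2l (ltW t0) (le_ip_norm ip_inner (A p - A q) (p - q))).
have := growth p q; have := Ad p q; move: test.
set n := `|p - q|; set m := `|A p - A q| => test Adn grow.
have n0 : 0 < n.
  rewrite lt_neqAle normr_ge0 andbT; apply/eqP => n0.
  by move: test; rewrite -n0 expr0n/= !mulr0 ltxx.
have {}test : delta * n < t * m.
  by rewrite -(ltr_pM2r n0) -!mulrA -expr2.
rewrite ltr_pdivlMr ?mulr_gt0// in t1.
have nd : n < d.
  have : t * m <= t * (L * n + 1) by rewrite ler_pM2l.
  have : t * (2 * L) * n < delta * n by rewrite ltr_pM2r.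
  move=> h1 h2; have h3 : delta * n < delta * d by lra.
  by move: h3; rewrite ltr_pM2l.
have : t * m < t * (delta * (theta * eta)) by rewrite ltr_pM2l// Adn.
move=> h; rewrite -(ltr_pM2l de0); lra.
Qed.

Lemma weak_cluster_le (x : nat -> H) z w y (e : R) : weak_cluster ip x z ->
  (\forall k \near \oo, ip w (x k - y) <= e) -> ip w (z - y) <= e.
Proof.
move=> [phi [phiS zcl]] [N _ hN].
have phi_ge n : (n <= phi n)%N.
  by elim: n => // n IH; exact: leq_ltn_trans (phiS n).
rewrite (ipDr ip_inner) (ipNr ip_inner) lerBlDr.
have := zcl w; rewrite (ipC ip_inner z) => /cvgr_to_le; apply.
exists N => // n /= Nn; have := hN _ (leq_trans Nn (phi_ge n)).
by rewrite /= (ipDr ip_inner) (ipNr ip_inner) lerBlDr (ipC ip_inner w).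
Qed.

End Operators.

(** * Step sizes of the backtracking line search *)

Section StepSizes.
Variables (R : realType) (theta : R) (a : nat -> R) (jj : nat -> nat).
Hypothesis theta01 : 0 < theta < 1.
Hypothesis a0_gt0 : 0 < a 0%N.
Hypothesis aS : forall k, a k.+1 = a k * theta ^+ jj k.

Lemma step_gt0 k : 0 < a k.
Proof.
case/andP: theta01 => th0 _.
by elim: k => // k IH; rewrite aS mulr_gt0// exprn_gt0.
Qed.

Lemma step_nonincreasing n m : (n <= m)%N -> a m <= a n.
Proof.
case/andP: theta01 => th0 th1.
move=> /subnKC <-; elim: (m - n)%N => [|i IH]; first by rewrite addn0.
apply: le_trans IH; rewrite addnS aS ger_pMr ?step_gt0//.
by apply: exprn_ile1; exact: ltW.
Qed.

Lemma step_to0 : (forall N, exists2 k, (N <= k)%N & (0 < jj k)%N) ->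
  forall e : R, 0 < e -> \forall k \near \oo, a k < e.
Proof.
case/andP: theta01 => th0 th1 inf e e0.
have geom n : exists N, forall k, (N <= k)%N -> a k <= theta ^+ n * a 0%N.
  elim: n => [|n [N IH]].
    by exists 0%N => k _; rewrite mul1r step_nonincreasing.
  have [k Nk jk] := inf N; exists k.+1 => m km.
  apply: le_trans (step_nonincreasing km) _; rewrite aS exprS -mulrA mulrC.
  apply: ler_pM; [exact: exprn_ge0 (ltW th0)|exact/ltW/step_gt0| |exact: IH].
  by rewrite -(prednK jk) exprS ler_piMr ?(ltW th0)// exprn_ile1 ?ltW.
have th_norm : `|theta| < 1 by rewrite gtr0_norm.
have := cvg_expr th_norm => /cvgrPdist_lt/(_ _ (divr_gt0 e0 a0_gt0)).
move=> [n _ /(_ n (leqnn _))]; rewrite /= sub0r normrN ltr_pdivlMr// => thn.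
have [N hN] := geom n; exists N => // k /= Nk; apply: le_lt_trans (hN k Nk) _.
by apply: le_lt_trans thn; rewrite ler_pM2r// ler_norm.
Qed.

End StepSizes.

(** * Projections and doubling of variables *)

Section Projection.
Variables (R : realType) (H : completeNormedModType R) (ip : H -> H -> R).
Hypothesis ip_inner : is_inner_product ip.

Lemma proj_onto_id (C : set H) x : C x -> proj_onto C x = x.
Proof.
move=> Cx; have /(xgetPex 0) : exists p, [set p | is_proj C x p] p.
  by exists x; split=> // y _; rewrite subrr normr0.
rewrite -/(proj_onto C x) => -[_ /(_ x Cx)].
by rewrite subrr normr0 normr_le0 subr_eq0 => /eqP.
Qed.

Lemma proj_onto_halfspace (v b : H) (r : R) x : v != 0 -> r <= ip v (x - b) ->
  proj_onto [set y | ip v (y - b) <= r] x =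
    x - ((ip v (x - b) - r) / `|v| ^+ 2) *: v.
Proof.
move=> v0 rx; set C := [set y | _]; set l := _ / _; set p := x - _.
have V0 : 0 < `|v| ^+ 2 by rewrite exprn_gt0// normr_gt0.
have l0 : 0 <= l by rewrite divr_ge0 ?subr_ge0// ltW.
have lE : l * `|v| ^+ 2 = ip v (x - b) - r by rewrite divfK// gt_eqF.
(* This inequality shows that [p] is a nearest point and also that it is the only one, so the choice
   made by [proj_onto] must be [p]. *)
have key y : C y -> `|x - p| ^+ 2 + `|p - y| ^+ 2 <= `|x - y| ^+ 2.
  rewrite /C /= /p => Cy.
  have : 0 <= l * (r - ip v (y - b)) by rewrite mulr_ge0// subr_ge0.
  move: lE Cy; rewrite -!(ipxx ip_inner) => lE.
  rewrite (ipDr ip_inner) (ipNr ip_inner) in lE *.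
  have -> : x - (x - l *: v) = l *: v by rewrite opprB addrC subrK.
  move: lE; clearbody l; rewrite !(ipDl ip_inner, ipDr ip_inner, ipNl ip_inner,
    ipNr ip_inner, ipZl ip_inner, ipZr ip_inner).
  rewrite (ipC ip_inner x v) (ipC ip_inner y v) (ipC ip_inner y x).
  nra.
have Cp : C p.
  rewrite /C /p /= addrAC (ipDr ip_inner) (ipNr ip_inner) (ipZr ip_inner).
  by rewrite (ipxx ip_inner) lE subKr.
have Pp : is_proj C x p.
  split=> // y Cy; rewrite -(@ler_pXn2r _ 2) ?nnegrE//.
  by apply: le_trans (key y Cy); rewrite lerDl sqr_ge0.
have /(xgetPex 0) : exists p, [set p | is_proj C x p] p by exists p.
rewrite -/(proj_onto C x); move: (proj_onto C x) => q [Cq /(_ p Cp) qp].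
have : `|x - q| ^+ 2 <= `|x - p| ^+ 2 by rewrite ler_pXn2r ?nnegrE.
move=> /(le_trans (key q Cq)); rewrite gerDl.
by rewrite exprn_even_le0//= normr_eq0 subr_eq0 => /eqP.
Qed.

End Projection.

(* A discrete doubling-of-variables estimate for [D i j = |x i - x j| ^ 2]:
   the step sizes vary, so the comparison is made at equal elapsed times [t]
   rather than at equal indices. *)
Lemma double_index_estimate (R : realType) (n : nat) (D : nat -> nat -> R)
    (lam t g u : nat -> R) (L C0 C1 C2 : R) :
  0 <= C1 -> 0 <= C2 ->
  (forall i j, D i j = D j i) ->
  (forall i, (i < n)%N -> 0 < lam i) ->
  (forall i, (i < n)%N -> t i.+1 = t i + lam i) ->
  (forall i, (i < n)%N -> g i <= u i - u i.+1) ->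
  (forall i, (i < n)%N -> L * lam i ^+ 2 <= C2 * g i) ->
  (forall i j, (i < n)%N -> (j < n)%N ->
    (lam i + lam j) * D i.+1 j.+1 <=
    lam j * D i j.+1 + lam i * D i.+1 j + C1 * (lam j * g i + lam i * g j)) ->
  (forall i, (i <= n)%N ->
    D i 0%N <= L * (t i - t 0%N) ^+ 2 + C0 + (C1 + C2) * (u 0%N - u i)) ->
  forall i j, (i <= n)%N -> (j <= n)%N ->
    D i j <= L * (t i - t j) ^+ 2 + C0 + (C1 + C2) * (2 * u 0%N - u i - u j).
Proof.
move=> C10 C20 Dsym lam0 tS gu Lg step base.
elim=> [|i IHi] j; first by move=> _ jn; rewrite Dsym; have := base _ jn; lra.
move=> iN; elim: j => [|j IHj] jN; first by have := base _ iN; lra.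
have li := lam0 _ iN; have lj := lam0 _ jN.
rewrite -(ler_pM2l (addr_gt0 li lj)); apply: le_trans (step i j iN jN) _.
have h1 : lam j * D i j.+1 <= _ := ler_wpM2l (ltW lj) (IHi j.+1 (ltnW iN) jN).
have h2 : lam i * D i.+1 j <= _ := ler_wpM2l (ltW li) (IHj (ltnW jN)).
apply: le_trans (lerD (lerD h1 h2) (lexx _)) _.
(* With weights [lam j] and [lam i] the cross terms of the two squared time differences cancel. The
   surplus [L * lam ^+ 2] is at most [C2 * g], and all terms in [g] are absorbed by the decrease of
   [u]. *)
have g1 := ler_wpM2l (addr_ge0 C10 C20) (ler_wpM2l (ltW lj) (gu _ iN)).
have g2 := ler_wpM2l (addr_ge0 C10 C20) (ler_wpM2l (ltW li) (gu _ jN)).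
have k1 := ler_wpM2l (ltW lj) (Lg _ iN); have k2 := ler_wpM2l (ltW li) (Lg _ jN).
rewrite (tS _ iN) (tS _ jN); lra.
Qed.

(** * The iteration *)

Section Iteration.
Variables (R : realType) (H : completeNormedModType R) (ip : H -> H -> R).
Variables (A1 A2 : H -> H) (B : H -> set H) (beta delta deltabar : R).
Variables (x xb : nat -> H) (al : nat -> R).

Let ds k := x k - xb k.
Let v k := (al k)^-1 *: ds k - (A2 (x k) - A2 (xb k)).
Let r k := deltabar / al k * `|ds k| ^+ 2.
Let kappa := 1 - delta - deltabar.
Let c := (1 - delta)^-1.

Hypothesis ip_inner : is_inner_product ip.
Hypothesis beta0 : 0 < beta.
Hypothesis cocoA1 : cocoercive ip beta A1.
Hypothesis monoA2 : forall p q, 0 <= ip (A2 p - A2 q) (p - q).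
Hypothesis monoB : monotone_op ip B.
Hypothesis delta01 : 0 < delta < 1.
Hypothesis deltabar0 : 0 < deltabar.
Hypothesis kappa0 : 0 < kappa.
Hypothesis al0 : forall k, 0 < al k.
Hypothesis al_le : forall k, al k <= 4 * beta * deltabar.
Hypothesis Bxb : forall k, B (xb k) ((al k)^-1 *: ds k - (A1 (x k) + A2 (x k))).
Hypothesis test : forall k,
  al k * ip (A2 (x k) - A2 (xb k)) (ds k) <= delta * `|ds k| ^+ 2.
Hypothesis xS : forall k,
  x k.+1 = proj_onto [set y | ip (v k) (y - xb k) <= r k] (x k).
Hypothesis nonstop : forall k, x k.+1 <> x k.

(** * A single step of the method *)

Let ipE := ip_expand ip_inner.

Let lam k := (ip (v k) (ds k) - r k) / `|v k| ^+ 2.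

Let r_ge0 k : 0 <= r k.
Proof. by rewrite mulr_ge0 ?sqr_ge0// divr_ge0// ltW. Qed.

Let c1 : 1 <= c.
Proof. by rewrite /c invf_ge1; move: delta01; lra. Qed.

Let ip_v_ds k : (1 - delta) * `|ds k| ^+ 2 <= al k * ip (v k) (ds k).
Proof.
have -> : al k * ip (v k) (ds k) =
    `|ds k| ^+ 2 - al k * ip (A2 (x k) - A2 (xb k)) (ds k).
  rewrite /v; move: (ds k) (A2 (x k) - A2 (xb k)) => z w.
  rewrite (ipDl ip_inner) (ipNl ip_inner) (ipZl ip_inner) (ipxx ip_inner).
  by rewrite mulrBr mulrA divff ?gt_eqF// mul1r.
by have := test k; lra.
Qed.

Let al_r k : al k * r k = deltabar * `|ds k| ^+ 2.
Proof. by rewrite /r mulrA (mulrC (al k)) divfK ?gt_eqF. Qed.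

(** The line-search test costs the share [delta] of [|ds k| ^+ 2] and the slack [r k] the share
    [deltabar]; [kappa] is what remains. *)
Let violation k : kappa * `|ds k| ^+ 2 <= al k * (ip (v k) (ds k) - r k).
Proof. by rewrite mulrBr al_r; have := ip_v_ds k; rewrite /kappa; lra. Qed.

Let ds_neq0 k : ds k != 0.
Proof.
apply/eqP => d0; apply: (@nonstop k); rewrite xS proj_onto_id//= -/(ds k) d0.
by rewrite (ip0r ip_inner).
Qed.

Let ds_gt0 k : 0 < `|ds k|. Proof. by rewrite normr_gt0. Qed.

Let violation_gt0 k : 0 < ip (v k) (ds k) - r k.
Proof.
rewrite -(pmulr_rgt0 _ (al0 k)); apply: lt_le_trans (violation k).
by rewrite mulr_gt0// exprn_gt0.
Qed.

Let v_neq0 k : v k != 0.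
Proof.
apply/eqP => v0; have := violation_gt0 k; rewrite v0 (ip0l ip_inner).
by have := r_ge0 k; lra.
Qed.

Let v_gt0 k : 0 < `|v k|. Proof. by rewrite normr_gt0. Qed.

Let lam_gt0 k : 0 < lam k.
Proof. by rewrite divr_gt0// exprn_gt0. Qed.

Let lamE k : lam k * `|v k| ^+ 2 = ip (v k) (ds k) - r k.
Proof. by rewrite divfK// gt_eqF// exprn_gt0. Qed.

Let x_step k : x k.+1 = x k - lam k *: v k.
Proof.
by rewrite xS proj_onto_halfspace// -subr_ge0 ltW// violation_gt0.
Qed.

Let boundary k : ip (v k) (x k.+1 - xb k) = r k.
Proof.
rewrite x_step addrAC (ipDr ip_inner) (ipNr ip_inner) (ipZr ip_inner).
by rewrite (ipxx ip_inner) lamE subKr.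
Qed.

Let step_norm k : `|x k.+1 - x k| = lam k * `|v k|.
Proof. by rewrite x_step addrAC subrr add0r normrN normrZ gtr0_norm. Qed.

Let ds_le_v k : (1 - delta) * `|ds k| <= al k * `|v k|.
Proof.
rewrite -(ler_pM2r (ds_gt0 k)) -mulrA -expr2; apply: le_trans (ip_v_ds k) _.
by rewrite -mulrA ler_pM2l// le_ip_norm.
Qed.

Let step_le_ds k : lam k * `|v k| <= `|ds k|.
Proof.
rewrite -(ler_pM2r (v_gt0 k)) -mulrA -expr2 lamE mulrC.
by apply: le_trans (le_ip_norm ip_inner _ _); rewrite gerBl.
Qed.

Let ds_le_cv k : `|ds k| <= c * (al k * `|v k|).
Proof.
rewrite /c mulrC ler_pdivlMr; last by move: delta01; lra.
by rewrite mulrC.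
Qed.

Let inv4beta k : (4 * beta)^-1 <= deltabar / al k.
Proof.
rewrite ler_pdivlMr// mulrC ler_pdivrMr; last by rewrite mulr_gt0.
by rewrite mulrC; exact: al_le.
Qed.

Let shift_ge k (z : H) : - (deltabar / al k * `|z| ^+ 2) <= - `|z| ^+ 2 / (4 * beta).
Proof. by rewrite mulNr lerN2 mulrC ler_wpM2r// sqr_ge0. Qed.

(** [v k] is [A1 (x k) + A2 (xb k)] plus an element of [B (xb k)], so only [A1] is taken at the
    wrong point, at a cost of at most [r k]. *)
Let graph_pair y b k : B y b ->
  - r k <= ip (v k - (A1 y + A2 y + b)) (xb k - y).
Proof.
move=> Byb.
have h1 := cocoercive_shift ip_inner beta0 cocoA1 (x k) y (xb k) y.
rewrite subrr subr0 in h1.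
have h2 := monoB (Bxb k) Byb; rewrite (ipC ip_inner) in h2.
have h3 := monoA2 (xb k) y.
have := shift_ge k (ds k); rewrite -/(r k) => h4.
have -> : ip (v k - (A1 y + A2 y + b)) (xb k - y) =
     ip (A1 (x k) - A1 y) (xb k - y) + ip (A2 (xb k) - A2 y) (xb k - y)
   + ip ((al k)^-1 *: ds k - (A1 (x k) + A2 (x k)) - b) (xb k - y).
  by rewrite /v; move: (xb k - y) (ds k) => p q; rewrite !ipE; ring.
by move: h1 h2 h3 h4; rewrite -/(ds k); lra.
Qed.

(* Quadratic terms cancel because [1 / (4 * beta) <= deltabar / al k]: the slack
   [r k] of the half-space pays for evaluating [A1] at [x k], not at [xb k]. *)
Let graph_step y b k : B y b ->
  2 * lam k * ip (A1 y + A2 y + b) (xb k - y) <=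
  `|x k - y| ^+ 2 - `|x k.+1 - y| ^+ 2 - `|x k.+1 - x k| ^+ 2.
Proof.
move=> Byb; set w := A1 y + A2 y + b.
have pair := graph_pair k Byb; rewrite -/w in pair.
have bnd := boundary k.
have e1 : x k.+1 - xb k = (x k.+1 - y) - (xb k - y).
  by rewrite opprB addrA subrK.
rewrite {}e1 (ipDr ip_inner) (ipNr ip_inner) in bnd.
rewrite (ipDl ip_inner) (ipNl ip_inner) in pair.
have e2 : `|x k - y| ^+ 2 = `|x k.+1 - y| ^+ 2 + 2 * lam k * ip (v k) (x k.+1 - y)
    + `|x k.+1 - x k| ^+ 2.
  have -> : x k - y = (x k.+1 - y) + lam k *: v k by rewrite x_step addrAC subrK.
  rewrite step_norm exprMn -!(ipxx ip_inner).
  by move: (x k.+1 - y) (v k) (lam k) => p q l; rewrite !ipE (ipC ip_inner p q); ring.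
have : 2 * lam k * ip w (xb k - y) <= 2 * lam k * ip (v k) (x k.+1 - y).
  by rewrite (ler_pM2l (mulr_gt0 (ltr0n _ 2) (lam_gt0 k))); lra.
rewrite e2; lra.
Qed.

(** * Comparison of two iterates with equal step sizes *)

Let pair_monotone k m :
  - (`|ds k - ds m| ^+ 2 / (4 * beta)) <= ip (v k - v m) (xb k - xb m).
Proof.
have h1 := cocoercive_shift ip_inner beta0 cocoA1 (x k) (x m) (xb k) (xb m).
have h2 := monoB (Bxb k) (Bxb m); rewrite (ipC ip_inner) in h2.
have h3 := monoA2 (xb k) (xb m).
have -> : ip (v k - v m) (xb k - xb m) = ip (A1 (x k) - A1 (x m)) (xb k - xb m)
   + ip (A2 (xb k) - A2 (xb m)) (xb k - xb m)
   + ip ((al k)^-1 *: ds k - (A1 (x k) + A2 (x k))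
     - ((al m)^-1 *: ds m - (A1 (x m) + A2 (x m)))) (xb k - xb m).
  rewrite /v; move: (xb k - xb m) (ds k) (ds m) => p q s; rewrite !ipE; ring.
by move: h1 h2 h3; rewrite -!/(ds _) mulNr; lra.
Qed.

(* The step [lam k] never exceeds [c * al k]; this is the converse bound, which
   holds as soon as [v k] is not small. *)
Let proportionate k := kappa * al k <= 4 * lam k.

(** Approximate monotonicity is available at the points [xb]. Since [x k.+1] lies on the boundary of
    its half-space, passing to the new iterates costs only [r k], [r m] and two cross terms, which
    Young's inequality bounds. *)
Let pair_error k m : al k = al m ->
  - ip (v k - v m) (x k.+1 - x m.+1) <=
  3 * c ^+ 2 * al k * (`|v k| ^+ 2 + `|v m| ^+ 2).
Proof.
move=> alkm.
have e : ip (v k - v m) (x k.+1 - x m.+1) = r k + r m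
    - ip (v k) (x m.+1 - xb m) - ip (v m) (x k.+1 - xb k)
    + ip (v k - v m) (xb k - xb m).
  rewrite -(boundary k) -(boundary m); move: (v k) (v m) => p q.
  by rewrite !ipE; ring.
have gap j : `|x j.+1 - xb j| <= 2 * (c * (al j * `|v j|)).
  have -> : x j.+1 - xb j = ds j - lam j *: v j by rewrite x_step addrAC.
  apply: le_trans (ler_normB _ _) _; rewrite normrZ gtr0_norm//.
  by have := step_le_ds j; have := ds_le_cv j; lra.
have r_le j : r j <= c ^+ 2 * al j * `|v j| ^+ 2.
  rewrite -(ler_pM2l (al0 j)) al_r.
  have h : `|ds j| ^+ 2 <= (c * (al j * `|v j|)) ^+ 2.
    by rewrite ler_pXn2r ?nnegrE// (le_trans _ (ds_le_cv j)).
  have db1 : deltabar <= 1 by move: kappa0 delta01; rewrite /kappa; lra.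
  have : deltabar * `|ds j| ^+ 2 <= `|ds j| ^+ 2 by rewrite ler_piMl ?sqr_ge0.
  by move: h; rewrite !exprMn; lra.
have cross p q j : `|q| <= 2 * (c * (al j * `|v j|)) ->
    ip p q <= c * al j * (`|p| ^+ 2 + `|v j| ^+ 2).
  move=> hq; apply: le_trans (le_ip_norm ip_inner _ _) _.
  apply: le_trans (ler_wpM2l (normr_ge0 p) hq) _.
  have caj : 0 <= c * al j by rewrite mulr_ge0 ?ltW// (lt_le_trans _ c1).
  have := mulr_ge0 caj (sqr_ge0 (`|p| - `|v j|)).
  by rewrite sqrrB; lra.
have k1 := cross (v k) _ _ (gap m); have k2 := cross (v m) _ _ (gap k).
have k3 := pair_monotone k m; have k4 := r_le k; have k5 := r_le m.
have k6 : `|ds k - ds m| ^+ 2 / (4 * beta) <= 2 * (r k + r m).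
  have := shift_ge k (ds k - ds m); rewrite mulNr lerN2 => /le_trans; apply.
  have dak : 0 <= deltabar / al k by rewrite divr_ge0// ltW.
  have : `|ds k - ds m| ^+ 2 <= 2 * (`|ds k| ^+ 2 + `|ds m| ^+ 2).
    have := sqr_ge0 `|ds k + ds m|; rewrite -!(ipxx ip_inner).
    by move: (ds k) (ds m) => p q; rewrite !ipE (ipC ip_inner q p); lra.
  by move/(ler_wpM2l dak); rewrite /r -alkm; lra.
rewrite e -alkm in k1 k4 k5 *.
have cc : c * al k * (`|v k| ^+ 2 + `|v m| ^+ 2) <=
    c ^+ 2 * al k * (`|v k| ^+ 2 + `|v m| ^+ 2).
  rewrite ler_wpM2r ?addr_ge0 ?sqr_ge0// ler_wpM2r ?(ltW (al0 k))// expr2.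
  by rewrite ler_peMl// (le_trans _ c1).
by lra.
Qed.

(** Expanding the two squares around [x k.+1 - x m.+1] leaves the cross term [2 * lam k * lam m * ip
    (v k - v m) (x k.+1 - x m.+1)]. Its bound carries a factor [al k], which proportionality trades
    for [lam], so that the error consists of squared steps, and these are summable. *)
Let double_step k m : al k = al m -> proportionate k -> proportionate m ->
  (lam k + lam m) * `|x k.+1 - x m.+1| ^+ 2 <=
  lam m * `|x k - x m.+1| ^+ 2 + lam k * `|x k.+1 - x m| ^+ 2
  + 24 * c ^+ 2 / kappa *
    (lam m * `|x k.+1 - x k| ^+ 2 + lam k * `|x m.+1 - x m| ^+ 2).
Proof.
move=> alkm pk pm; have err := pair_error alkm.
have -> : x k - x m.+1 = (x k.+1 - x m.+1) + lam k *: v k.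
  by rewrite (x_step k) addrAC subrK.
have -> : x k.+1 - x m = (x k.+1 - x m.+1) - lam m *: v m.
  by rewrite (x_step m) opprB addrA addrAC addrK.
rewrite !step_norm (exprMn 2 (lam k)) (exprMn 2 (lam m)).
move: err; move: (x k.+1 - x m.+1) => z err.
have lk := lam_gt0 k; have lm := lam_gt0 m.
have ak j : proportionate j -> al j = al k ->
    al k * `|v j| ^+ 2 <= 4 / kappa * (lam j * `|v j| ^+ 2).
  move=> pj <-; rewrite [leRHS]mulrA ler_wpM2r ?sqr_ge0// mulrAC ler_pdivlMr// mulrC.
  exact: pj.
have h1 := ak _ pk erefl; have h2 := ak _ pm (esym alkm).
have c20 : 0 <= 6 * c ^+ 2 by rewrite mulr_ge0// sqr_ge0.
have : 2 * - ip (v k - v m) z <= 24 * c ^+ 2 / kappa *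
    (lam k * `|v k| ^+ 2 + lam m * `|v m| ^+ 2).
  have := ler_wpM2l c20 (lerD h1 h2).
  have -> : 6 * c ^+ 2 * (4 / kappa * (lam k * `|v k| ^+ 2) +
      4 / kappa * (lam m * `|v m| ^+ 2)) = 24 * c ^+ 2 / kappa *
      (lam k * `|v k| ^+ 2 + lam m * `|v m| ^+ 2) by ring.
  by move: err; lra.
move/(ler_wpM2l (mulr_ge0 (ltW lk) (ltW lm))).
have pos (p q : R) (w : H) : 0 < p -> 0 < q -> 0 <= p * q * (p * `|w| ^+ 2).
  by move=> p0 q0; rewrite pmulr_rge0 ?mulr_gt0// pmulr_rge0// sqr_ge0.
have m1 := pos _ _ (v k) lk lm; have m2 := pos _ _ (v m) lm lk.
move: m1 m2; rewrite -!(ipxx ip_inner).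
move: (lam k) (lam m) (v k) (v m) => a b p q.
by rewrite !ipE (ipC ip_inner z p) (ipC ip_inner z q); lra.
Qed.

(** * Fejer monotonicity and vanishing displacements *)

Hypothesis ucA2 : unif_cont_op A2.
Variables s0 b0 : H.
Hypothesis Bs0 : B s0 b0.
Hypothesis s0_zero : A1 s0 + A2 s0 + b0 = 0.

Let u k := `|x k - s0| ^+ 2.

Let fejer k : `|x k.+1 - x k| ^+ 2 <= u k - u k.+1.
Proof.
have := graph_step k Bs0; rewrite s0_zero (ip0l ip_inner) mulr0.
by rewrite -/(u k) -/(u k.+1); lra.
Qed.

Let u_noninc n m : (n <= m)%N -> u m <= u n.
Proof.
move=> /subnKC <-; elim: (m - n)%N => [|i IH]; first by rewrite addn0.
apply: le_trans IH; rewrite addnS -subr_ge0.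
by apply: le_trans (fejer _); rewrite sqr_ge0.
Qed.

Let u_tail (e : R) : 0 < e ->
  \forall N \near \oo, forall n m, (N <= n)%N -> u n - u m <= e.
Proof.
move=> e0; have lb : lbound (range u) 0 by move=> _ [k _ <-]; rewrite sqr_ge0.
have hinf : has_inf (range u).
  by split; [exists (u 0%N), 0%N|exists 0].
have [_ [N0 _ <-] uN0] := inf_adherent e0 hinf.
exists N0 => // N /= N0N n m Nn.
have h1 := u_noninc (leq_trans N0N Nn).
have h2 : inf (range u) <= u m by apply: ge_inf; [exists 0|exists m].
by lra.
Qed.

Let step_to0 (e : R) : 0 < e -> \forall k \near \oo, `|x k.+1 - x k| < e.
Proof.
move=> e0; have e2 : 0 < e ^+ 2 / 2 by rewrite divr_gt0// exprn_gt0.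
have := u_tail e2; apply: filterS => k /(_ k k.+1 (leqnn _)) uk.
rewrite -(@ltr_pXn2r _ 2)// ?nnegrE ?(ltW e0)//.
by have := fejer k; lra.
Qed.

Let alv_le k :
  al k * `|v k| <= `|ds k| + al k * `|A2 (x k) - A2 (xb k)|.
Proof.
have ak := al0 k; rewrite -{1}(gtr0_norm ak) -normrZ /v.
rewrite scalerBr scalerA divff ?gt_eqF// scale1r.
by apply: le_trans (ler_normB _ _) _; rewrite normrZ gtr0_norm.
Qed.

Let al_lam_v k : kappa * `|ds k| ^+ 2 <= al k * (lam k * `|v k| ^+ 2).
Proof. by rewrite lamE; exact: violation. Qed.

(** No lower bound on [al k] is available. If [e <= |ds k|], growth of [A2] gives
    [al k * |v k| <= K * |ds k|], and the violation of the half-space then forces a step of length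
    at least [kappa * e / K]; but the steps tend to [0]. *)
Lemma ds_to0 (e : R) : 0 < e -> \forall k \near \oo, `|ds k| < e.
Proof.
move=> e0; have [L L0 growth] := unif_cont_growth ucA2.
pose a := 4 * beta * deltabar; have a0 : 0 < a by rewrite !mulr_gt0.
pose K := 1 + a * L + a / e.
have K0 : 0 < K by rewrite !addr_gt0 ?mulr_gt0 ?invr_gt0.
have := step_to0 (divr_gt0 (mulr_gt0 kappa0 e0) K0).
apply: filterS => k; rewrite ltr_pdivlMr// step_norm => small.
rewrite ltNge; apply/negP => eds.
have D0 := ds_gt0 k.
have h1 : al k * `|v k| <= `|ds k| * K.
  apply: le_trans (alv_le k) _.
  have g := growth (x k) (xb k); rewrite -/(ds k) in g.
  have g' : al k * `|A2 (x k) - A2 (xb k)| <= a * (L * `|ds k| + 1).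
    by apply: ler_pM => //; exact: ltW.
  have : a <= a / e * `|ds k|.
    by rewrite mulrAC ler_pdivlMr// ler_pM2l.
  by rewrite /K; lra.
have h2 := al_lam_v k.
have : kappa * `|ds k| ^+ 2 <= (lam k * `|v k|) * (`|ds k| * K).
  apply: le_trans h2 _.
  have -> : al k * (lam k * `|v k| ^+ 2) = (lam k * `|v k|) * (al k * `|v k|).
    by rewrite expr2; ring.
  by apply: ler_wpM2l h1; apply: mulr_ge0 => //; exact/ltW/lam_gt0.
rewrite expr2 mulrA mulrA [leRHS]mulrAC ler_pM2r// => h3.
by have := ler_wpM2l (ltW kappa0) eds; lra.
Qed.

Lemma gap_to0 (e : R) : 0 < e -> \forall k \near \oo, `|A2 (x k) - A2 (xb k)| < e.
Proof.
move=> e0; have [d d0 A2d] := ucA2 e0.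
by have := ds_to0 d0; apply: filterS => k; exact: A2d.
Qed.

(** Once the gap of [A2] is below [|v k| / 2], one has [al k * |v k| <= 2 * |ds k|]; inserting this
    into [al_lam_v] gives the claim. *)
Let fast_proportionate (eta : R) : 0 < eta ->
  \forall k \near \oo, eta <= `|v k| -> proportionate k.
Proof.
move=> eta0; have := gap_to0 (divr_gt0 eta0 (ltr0n _ 2)).
apply: filterS => k gapk fast; rewrite /proportionate.
have ak := al0 k; have V0 := v_gt0 k.
have h : al k * `|v k| <= 2 * `|ds k|.
  have : al k * `|A2 (x k) - A2 (xb k)| <= al k * (`|v k| / 2).
    by rewrite ler_pM2l//; lra.
  by have := alv_le k; lra.
have h2 : (al k * `|v k|) ^+ 2 <= (2 * `|ds k|) ^+ 2.
  by rewrite ler_pXn2r ?nnegrE ?mulr_ge0 ?(ltW ak).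
rewrite -(ler_pM2l (mulr_gt0 ak (exprn_gt0 2 V0))).
have := ler_wpM2l (ltW kappa0) h2; have := al_lam_v k.
by rewrite !(exprMn 2 _ `|_|); lra.
Qed.

(** * Elapsed time and runs of constant step size *)

Let tm k := \sum_(i < k) lam i.

Let tmS k : tm k.+1 = tm k + lam k.
Proof. by rewrite /tm big_ord_recr. Qed.

Let tm_nondec n m : (n <= m)%N -> tm n <= tm m.
Proof.
move=> /subnKC <-; elim: (m - n)%N => [|i IH]; first by rewrite addn0.
by apply: le_trans IH _; rewrite addnS tmS lerDl; exact/ltW/lam_gt0.
Qed.

(* The point [xb s] carries an element of the graph of [A1 + A2 + B] of norm at
   most [2 * eta], which bounds the speed at which the later iterates can leave
   its neighbourhood. *)
Let leave_slow_point (eta A : R) s n : 0 < eta -> 0 < A ->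
  `|v s| < eta -> `|ds s| <= beta * eta ->
  (forall k, (s <= k)%N -> 2 * `|ds k| <= A) -> (s < n)%N ->
  `|x n - xb s| <= A + 4 * eta * (tm n - tm s.+1).
Proof.
move=> eta0 A0 slow dss dsA; elim: n => // n IH; rewrite ltnS leq_eqVlt.
move=> /predU1P[<-|sn].
  rewrite subrr mulr0 addr0; apply: le_trans (dsA s (leqnn _)).
  have -> : x s.+1 - xb s = ds s - lam s *: v s by rewrite x_step addrAC.
  apply: le_trans (ler_normB _ _) _; rewrite normrZ gtr0_norm//.
  by have := step_le_ds s; lra.
have {IH} := IH sn; rewrite (tmS n); have := tm_nondec sn.
set T := tm n - tm s.+1; rewrite -subr_ge0 -/T => T0.
have -> : tm n + lam n - tm s.+1 = T + lam n by rewrite addrAC.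
set G := A + 4 * eta * T; set q := `|x n - xb s| => qG.
have AG : A <= G by rewrite lerDl mulr_ge0// mulr_ge0// ltW.
have ln := lam_gt0 n.
pose w := A1 (xb s) + A2 (xb s) + ((al s)^-1 *: ds s - (A1 (x s) + A2 (x s))).
have w_le : `|w| <= 2 * eta.
  have -> : w = v s - (A1 (x s) - A1 (xb s)).
    rewrite /w /v; move: (_ *: _) => p; rewrite !opprD !opprK.
    rewrite addrC -!addrA; congr (p + _).
    by rewrite addrCA; congr (_ + _); rewrite addrA addrC.
  apply: le_trans (ler_normB _ _) _.
  have := cocoercive_lipschitz ip_inner beta0 cocoA1 (x s) (xb s).
  have : beta^-1 * `|ds s| <= eta by rewrite mulrC ler_pdivrMr// mulrC.
  by rewrite -/(ds s); lra.
have ipw : - (2 * eta * (q + A)) <= ip w (xb n - xb s).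
  have h : `|xb n - xb s| <= q + A.
    have -> : xb n - xb s = (x n - xb s) - ds n.
      by rewrite /ds addrAC subKr.
    apply: le_trans (ler_normB _ _) _; rewrite lerD2l.
    by have := dsA n (ltnW sn); have := normr_ge0 (ds n); lra.
  have := ler_normr_ip ip_inner w (xb n - xb s); rewrite ler_norml => /andP[+ _].
  apply: le_trans; rewrite lerN2; apply: ler_pM => //.
have := graph_step n (Bxb s); rewrite -/w -/q => h.
(* As [q + A <= 2 * G], the increment [4 * lam n * eta * (q + A)] fits into the cross term of the
   square on the right. *)
have h' : `|x n.+1 - xb s| ^+ 2 <= (G + 4 * eta * lam n) ^+ 2.
  have h1 := ler_wpM2l (ltW (mulr_gt0 (ltr0n _ 2) ln)) ipw.
  have q0 : 0 <= q := normr_ge0 _.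
  have h2 : q ^+ 2 <= G ^+ 2 by rewrite ler_pXn2r ?nnegrE// (le_trans q0 qG).
  have h3 : lam n * eta * (q + A) <= lam n * eta * (2 * G).
    by rewrite ler_pM2l ?(mulr_gt0 ln)//; lra.
  have := sqr_ge0 `|x n.+1 - x n|; have := sqr_ge0 (4 * eta * lam n).
  by rewrite sqrrD; lra.
have -> : A + 4 * eta * (T + lam n) = G + 4 * eta * lam n by rewrite /G; ring.
have p1 := mulr_gt0 eta0 ln.
have G0 : 0 <= G + 4 * eta * lam n by lra.
by move: h'; rewrite ler_pXn2r ?nnegrE.
Qed.

Let near_from (P : nat -> Prop) : (\forall k \near \oo, P k) ->
  \forall N \near \oo, forall k, (N <= k)%N -> P k.
Proof.
move=> [N0 _ hN0]; exists N0 => // N /= N0N k Nk.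
by apply: hN0; exact: leq_trans N0N Nk.
Qed.

Let run_estimate (eta e : R) : 0 < eta -> 0 < e ->
  \forall N \near \oo, forall s n, (N <= s)%N -> `|v s| < eta ->
  (forall k, (s < k < s.+1 + n)%N -> eta <= `|v k| /\ al k = al s.+1) ->
  forall i j, (i <= n)%N -> (j <= n)%N ->
    `|x (s.+1 + i)%N - x (s.+1 + j)%N| ^+ 2 <=
    32 * eta ^+ 2 * (tm (s.+1 + i)%N - tm (s.+1 + j)%N) ^+ 2 + e.
Proof.
move=> eta0 e0; pose C1 := 24 * c ^+ 2 / kappa; pose C := C1 + 32.
have C10 : 0 <= C1.
  by rewrite mulr_ge0 ?invr_ge0 ?(ltW kappa0)// mulr_ge0// sqr_ge0.
have C0 : 0 < C by rewrite ltr_wpDl.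
pose A : R := Num.min 1 (e / 16).
have A0 : 0 < A by rewrite lt_min ltr01 divr_gt0.
have A1' : A <= 1 by rewrite ge_min lexx.
have Ae : A <= e / 16 by rewrite ge_min lexx orbT.
have near_ds := near_from (ds_to0 (divr_gt0 A0 (ltr0n _ 2))).
have near_fast := near_from (fast_proportionate eta0).
have near_u := u_tail (divr_gt0 e0 (mulr_gt0 (ltr0n _ 4) C0)).
have near_s := near_from (ds_to0 (mulr_gt0 beta0 eta0)).
apply: (filterS _ (filterI (filterI near_ds near_fast) (filterI near_u near_s))).
move=> N [[hds hfast] [hu hs]] s n Ns slow run i j iN jN.
have dsA k : (s <= k)%N -> 2 * `|ds k| <= A.
  by move=> sk; have := hds k (leq_trans Ns sk); lra.
have dss : `|ds s| <= beta * eta by exact: ltW (hs s Ns).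
have inrun l : (l < n)%N -> (s < s.+1 + l < s.+1 + n)%N.
  by move=> ln; rewrite ltn_add2l ln andbT ltnS leq_addr.
have prop l : (l < n)%N -> proportionate (s.+1 + l).
  move=> /inrun ln; apply: hfast; last by have [] := run _ ln.
  by case/andP: ln => /ltnW + _; exact: leq_trans.
have alE l : (l < n)%N -> al (s.+1 + l) = al s.+1.
  by move=> /inrun /run[].
have ut m : u s.+1 - u m <= e / (4 * C).
  by apply: hu; exact: leqW.
have esc l : `|x (s.+1 + l) - xb s| <= A + 4 * eta * (tm (s.+1 + l) - tm s.+1).
  by apply: leave_slow_point; rewrite // leq_addr.
(* The constants come from the base case, [(2 * A + 4 * eta * T) ^+ 2 <= 8 * A ^+ 2 + 32 * eta ^+ 2
   * T ^+ 2], and from [eta <= |v k|] on the run, which allows [C2 = 32]. *)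
apply: le_trans (@double_index_estimate R n
  (fun i j => `|x (s.+1 + i)%N - x (s.+1 + j)%N| ^+ 2)
  (fun i => lam (s.+1 + i)) (fun i => tm (s.+1 + i))
  (fun i => `|x (s.+1 + i).+1 - x (s.+1 + i)%N| ^+ 2)
  (fun i => u (s.+1 + i)) (32 * eta ^+ 2) (8 * A ^+ 2) C1 32 C10 _
  _ _ _ _ _ _ _ i j iN jN) _.
- by [].
- by move=> k l; rewrite distrC.
- by move=> k _; exact: lam_gt0.
- by move=> k _; rewrite addnS tmS.
- by move=> k _; rewrite addnS; exact: fejer.
- move=> k kn; rewrite step_norm (exprMn 2 (lam _)).
  have [fast _] := run _ (inrun _ kn).
  have : eta ^+ 2 <= `|v (s.+1 + k)| ^+ 2.
    by rewrite ler_pXn2r ?nnegrE ?(ltW eta0)// (le_trans (ltW eta0)).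
  move/(ler_wpM2l (sqr_ge0 (lam (s.+1 + k)))); lra.
- move=> k l kn ln; rewrite !addnS; apply: double_step.
  + by rewrite !alE.
  + exact: prop.
  + exact: prop.
- move=> k kn; rewrite addn0.
  set T := tm (s.+1 + k) - tm s.+1.
  have T0 : 0 <= T by rewrite subr_ge0 tm_nondec// leq_addr.
  have h1 := esc k; have := esc 0%N; rewrite addn0 subrr mulr0 addr0 -/T in h1 * => h2.
  have h3 : `|x (s.+1 + k)%N - x s.+1| <= 2 * A + 4 * eta * T.
    have -> : x (s.+1 + k)%N - x s.+1 = (x (s.+1 + k)%N - xb s) - (x s.+1 - xb s).
      by rewrite opprB addrA subrK.
    by apply: le_trans (ler_normB _ _) _; lra.
  have h4 : `|x (s.+1 + k)%N - x s.+1| ^+ 2 <= (2 * A + 4 * eta * T) ^+ 2.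
    by rewrite ler_pXn2r ?nnegrE// (le_trans _ h3).
  have h5 := sqr_ge0 (2 * A - 4 * eta * T).
  have h6 : 0 <= (C1 + 32) * (u s.+1 - u (s.+1 + k)%N).
    by rewrite mulr_ge0 ?(ltW C0)// subr_ge0 u_noninc// leq_addr.
  by lra.
rewrite addn0 -/C.
have hC : C * (2 * u s.+1 - u (s.+1 + i)%N - u (s.+1 + j)%N) <= e / 2.
  have -> : e / 2 = C * (e / (4 * C) + e / (4 * C)).
    by field; rewrite gt_eqF.
  by rewrite ler_pM2l//; have := ut (s.+1 + i)%N; have := ut (s.+1 + j)%N; lra.
have : 8 * A ^+ 2 <= e / 2.
  have : A * A <= A * 1 by rewrite ler_pM2l.
  by rewrite expr2; lra.
by lra.
Qed.

(** * The variational inequality along the whole sequence *)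

Hypothesis slow_infinitely_often : forall (eta : R) N, 0 < eta ->
  exists2 s, (N <= s)%N & `|v s| < eta.
Hypothesis fast_al : forall eta : R, 0 < eta ->
  \forall k \near \oo, eta <= `|v k.+1| -> al k.+1 = al k.

Let x_bounded y k : `|x k - y| <= `|x 0%N - s0| + `|s0 - y|.
Proof.
rewrite -(subrKA s0 (x k)); apply: le_trans (ler_normD _ _) _.
by rewrite lerD2r -(@ler_pXn2r _ 2) ?nnegrE//; exact: (u_noninc (leq0n k)).
Qed.

(** Because [r k < ip (v k) (ds k)], [graph_pair] gives [ip w (xb k - y) <= ip (v k) (x k - y)],
    which is small when [v k] is. *)
Let slow_bound y b (eta : R) : B y b -> 0 < eta ->
  \forall k \near \oo, `|v k| < eta ->
  ip (A1 y + A2 y + b) (x k - y) <= (`|x 0%N - s0| + `|s0 - y| + 1) * eta.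
Proof.
move=> Byb eta0; set w := A1 y + A2 y + b.
have W0 : 0 < `|w| + 1 by rewrite ltr_pwDr.
have := ds_to0 (divr_gt0 eta0 W0); apply: filterS => k.
rewrite ltr_pdivlMr// => dsk slow.
have pair := graph_pair k Byb; rewrite -/w (ipDl ip_inner) (ipNl ip_inner) in pair.
have rv := violation_gt0 k.
have xE : (xb k - y) + ds k = x k - y by rewrite addrC subrKA.
rewrite -xE (ipDr ip_inner).
have h1 : ip (v k) (xb k - y) + ip (v k) (ds k) <=
    eta * (`|x 0%N - s0| + `|s0 - y|).
  rewrite -(ipDr ip_inner) xE.
  apply: le_trans (le_ip_norm ip_inner _ _) _.
  by apply: ler_pM => //; exact: ltW.
have h2 := le_ip_norm ip_inner w (ds k); have := normr_ge0 (ds k).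
by lra.
Qed.

Let last_slow (eta : R) s1 k : `|v s1| < eta -> (s1 <= k)%N ->
  exists s, [/\ (s1 <= s)%N, (s <= k)%N, `|v s| < eta &
    forall j, (s < j <= k)%N -> eta <= `|v j|].
Proof.
move=> slow; elim: k => [|k IH].
  rewrite leqn0 => /eqP s10; exists s1; split=> //; first by rewrite s10.
  by move=> j /andP[s1j]; rewrite leqn0 => /eqP j0; rewrite j0 in s1j.
move=> s1k; have [slowk|fastk] := ltP `|v k.+1| eta.
  exists k.+1; split=> // j /andP[kj jk].
  by have := leq_trans kj jk; rewrite ltnn.
move: s1k; rewrite leq_eqVlt => /predU1P[s1k|/IH[s [s1s sk slows fast]]].
  by move: slow; rewrite s1k ltNge fastk.
exists s; split=> //; first exact: leqW.
move=> j /andP[sj]; rewrite leq_eqVlt => /predU1P[->//|jk].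
by apply: fast; rewrite sj.
Qed.

(* Let [k] be a fast index, [s] the last slow index before it and [m] the first
   index after it that is slow or at elapsed time at least [1] from [k]. By
   [run_estimate] the iterates between [k] and [m] move by O(eta), and summing
   [graph_step] from [k] to [m] then bounds the inner product. *)
Lemma limsup_graph y b (e : R) : B y b -> 0 < e ->
  \forall k \near \oo, ip (A1 y + A2 y + b) (x k - y) <= e.
Proof.
move=> Byb e0; set w := A1 y + A2 y + b.
pose M := `|x 0%N - s0| + `|s0 - y|.
have M0 : 0 <= M by rewrite addr_ge0.
(* Bound on the time from [k] to [m]: less than [1] up to [m.-1], then one step of size at most
   [c * al m.-1]. The constant [6] in [K] comes from [32 * Theta ^+ 2 + 1 <= 36 * Theta ^+ 2]. *)
pose Theta := 1 + c * (4 * beta * deltabar).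
have c0 : 0 < c by exact: lt_le_trans c1.
have Th1 : 1 <= Theta by rewrite lerDl mulr_ge0 ?(ltW c0)// !mulr_ge0// ltW.
pose K := 6 * Theta.
have K0 : 0 <= K by rewrite /K; lra.
(* [Z] dominates the coefficient of [eta] in every case below. *)
pose Z := `|w| * (K + 1) + M * K + M + 1.
have Z0 : 0 < Z.
  by rewrite ltr_wpDl// !addr_ge0// mulr_ge0// addr_ge0.
pose eta := e / Z.
have eta0 : 0 < eta by rewrite divr_gt0.
have etaZ : eta * Z = e by rewrite divfK// gt_eqF.
have Ke : 0 <= K * eta := mulr_ge0 K0 (ltW eta0).
have near_run := run_estimate eta0 (exprn_gt0 2 eta0).
have near_al := near_from (fast_al eta0).
have near_slow := near_from (slow_bound Byb eta0).
have near_ds := near_from (ds_to0 eta0).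
have [N [[hrun hal] [hslow hds]]] :=
  filter_ex (filterI (filterI near_run near_al) (filterI near_slow near_ds)).
rewrite -/w -/M in hslow.
have [s1 Ns1 slow1] := slow_infinitely_often N eta0.
exists s1 => // k /= s1k; rewrite -etaZ.
have [slowk|fastk] := ltP `|v k| eta.
  apply: le_trans (hslow k (leq_trans Ns1 s1k) slowk) _.
  rewrite mulrC ler_pM2l// /Z; have := normr_ge0 w.
  by have := mulr_ge0 (normr_ge0 w) K0; have := mulr_ge0 M0 K0; lra.
have [s [s1s sk slows fast]] := last_slow slow1 s1k.
have Ns := leq_trans Ns1 s1s.
have {}sk : (s < k)%N.
  by rewrite ltn_neqAle sk andbT; apply: contraTneq slows => ->; rewrite -leNgt.
pose P m := (k <= m)%N && ((`|v m| < eta) || (1 <= tm m - tm k)).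
have exP : exists m, P m.
  by have [m km slowm] := slow_infinitely_often k eta0; exists m; rewrite /P km slowm.
case: (ex_minnP exP) => m /andP[km stop] mmin.
have before j : (k <= j < m)%N -> eta <= `|v j| /\ tm j - tm k < 1.
  move=> /andP[kj jm]; have : ~~ P j.
    by apply/negP => /mmin; rewrite leqNgt jm.
  by rewrite /P kj /= negb_or -leNgt -ltNge => /andP.
have {}fast j : (s < j < m)%N -> eta <= `|v j|.
  move=> /andP[sj jm]; have [jk|kj] := leqP j k; first by apply: fast; rewrite sj.
  by have [] := before j _; rewrite ?(ltnW kj).
have km' : (k < m)%N.
  rewrite ltn_neqAle km andbT; apply: contraTneq stop => <-.
  by rewrite negb_or -leNgt fastk subrr ler10.
have alE i : (s.+1 + i < m)%N -> al (s.+1 + i) = al s.+1.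
  elim: i => [|i IH] im; first by rewrite addn0.
  rewrite addnS hal ?IH//.
  - by rewrite (leq_trans _ im)// addnS.
  - by rewrite (leq_trans Ns)// addSnnS leq_addr.
  - by rewrite -addnS; apply: fast; rewrite im andbT leq_addr.
have sm : (s.+1 <= m)%N := leq_trans sk (ltnW km').
have close j : (k <= j <= m)%N -> `|x j - x k| <= K * eta.
  move=> /andP[kj jm].
  have := hrun s (m - s.+1)%N Ns slows _ (j - s.+1)%N (k - s.+1)%N.
  rewrite !subnKC// ?(leq_trans sk kj)// !leq_sub2r// => /(_ _ isT isT).
  have tjk : 0 <= tm j - tm k <= Theta.
    rewrite subr_ge0 tm_nondec//=.
    have mk : (0 < m)%N by exact: leq_ltn_trans km'.
    have : tm j <= tm m.-1.+1 by rewrite prednK// tm_nondec.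
    have [_] : eta <= `|v m.-1| /\ tm m.-1 - tm k < 1.
      by apply: before; apply/andP; split; [rewrite -ltnS prednK|rewrite prednK].
    rewrite tmS /Theta.
    have : lam m.-1 <= c * (4 * beta * deltabar).
      rewrite -(ler_pM2r (v_gt0 m.-1)).
      apply: le_trans (step_le_ds _) _; apply: le_trans (ds_le_cv _) _.
      rewrite -[leRHS]mulrA; apply: ler_wpM2l; first exact: ltW.
      by apply: ler_wpM2r => //; exact: al_le.
    lra.
  move=> h; rewrite -(@ler_pXn2r _ 2) ?nnegrE//.
  apply: le_trans (h _) _.
    move=> l /andP[sl lm]; split; first by apply: fast; rewrite sl.
    by rewrite -(subnKC sl); apply: alE; rewrite subnKC.
  have t2 : (tm j - tm k) ^+ 2 <= Theta ^+ 2.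
    by case/andP: tjk => t0 tT; rewrite ler_pXn2r ?nnegrE// (le_trans t0).
  have T1 : 1 <= Theta ^+ 2 by rewrite exprn_ege1.
  have e20 := sqr_ge0 eta.
  have := ler_wpM2l e20 t2; have := ler_wpM2l e20 T1.
  by rewrite (exprMn 2 K eta) /K (exprMn 2 6 Theta); lra.
have diff j : (k <= j <= m)%N -> ip w (x k - y) - `|w| * (K * eta) <= ip w (x j - y).
  move=> /close cl; have -> : x j - y = (x j - x k) + (x k - y) by rewrite addrA subrK.
  rewrite (ipDr ip_inner (x j - x k)).
  have := ler_normr_ip ip_inner w (x j - x k); rewrite ler_norml => /andP[+ _].
  by have := ler_wpM2l (normr_ge0 w) cl; lra.
case/orP: stop => [slowm|long].
  have := hslow m (leq_trans Ns (ltnW sm)) slowm.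
  have := diff m; rewrite km leqnn => /(_ isT); rewrite /Z.
  by have := mulr_ge0 M0 K0; have := normr_ge0 w; nra.
(* A lower bound for [ip w (xb i - y)] for all [i] from [k] to [m.-1]. If positive, it is integrated
   over an elapsed time of at least [1], while [|x i - y| ^+ 2] changes only by O(eta). *)
pose Q := ip w (x k - y) - `|w| * (K * eta) - `|w| * eta.
have [Q0|Q0] := leP Q 0.
  move: Q0; rewrite /Q /Z; have := mulr_ge0 M0 K0; have := normr_ge0 w; nra.
have sum j : (k <= j <= m)%N ->
    2 * (tm j - tm k) * Q <= `|x k - y| ^+ 2 - `|x j - y| ^+ 2.
  move=> /andP[/subnKC <-]; elim: (j - k)%N => [|i IH] im.
    by rewrite addn0 !subrr mulr0 mul0r.
  have im' : (k + i <= m)%N by rewrite ltnW// -addnS.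
  have := IH im'; rewrite addnS tmS.
  have := graph_step (k + i)%N Byb; rewrite -/w.
  have Qi : Q <= ip w (xb (k + i)%N - y).
    have := diff (k + i)%N; rewrite leq_addr im' => /(_ isT).
    have -> : x (k + i)%N - y = (xb (k + i)%N - y) + ds (k + i)%N.
      by rewrite [RHS]addrC subrKA.
    rewrite (ipDr ip_inner _ (ds (k + i)%N)) /Q.
    have := le_ip_norm ip_inner w (ds (k + i)%N).
    have : `|ds (k + i)%N| <= eta.
      apply/ltW/hds; apply: leq_trans Ns _; apply: leq_trans (ltnW sk) _.
      exact: leq_addr.
    by move/(ler_wpM2l (normr_ge0 w)); lra.
  have := ler_wpM2l (ltW (mulr_gt0 (ltr0n _ 2) (lam_gt0 (k + i)%N))) Qi.
  by have := sqr_ge0 `|x (k + i).+1 - x (k + i)%N|; lra.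
have h1 := sum m; rewrite km leqnn in h1; have {h1} h1 := h1 isT.
have h2 : 2 * Q <= 2 * (tm m - tm k) * Q by rewrite ler_pM2r//; lra.
have h3 : `|x k - y| ^+ 2 - `|x m - y| ^+ 2 <= K * eta * (2 * M).
  have -> : `|x k - y| ^+ 2 - `|x m - y| ^+ 2 =
      (`|x k - y| - `|x m - y|) * (`|x k - y| + `|x m - y|) by ring.
  have hk := x_bounded y k; have hm := x_bounded y m.
  have d1 : `|x k - y| - `|x m - y| <= K * eta.
    have := close m; rewrite km leqnn => /(_ isT); rewrite distrC => cl.
    apply: le_trans cl; apply: le_trans (lerB_dist _ _) _.
    by rewrite opprB addrA subrK.
  apply: le_trans (ler_wpM2r _ d1) _; first by rewrite addr_ge0.
  by apply: ler_wpM2l => //; rewrite /M; lra.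
have : Q <= K * eta * M by lra.
rewrite /Q /Z; have := mulr_ge0 M0 (ltW eta0); have := ltW eta0; lra.
Qed.

End Iteration.

(** * From the algorithm to the abstract iteration *)

Unset Implicit Arguments.

(* Indexing: a 0 = alpha_{-1}, and a k.+1 = alpha_k; jj k = j(k);
   xb k = bar x^k. *)
Theorem theorem4p8 (R : realType) (H : completeNormedModType R)
  (ip : H -> H -> R) (A1 A2 : H -> H) (B : H -> set H)
  (beta theta delta deltabar : R)
  (x : nat -> H) (a : nat -> R) (jj : nat -> nat) (xb : nat -> H) :
  is_inner_product ip ->
  0 < beta -> cocoercive ip beta A1 ->
  maximally_monotone ip (single_op A2) -> unif_cont_op A2 ->
  maximally_monotone ip B ->
  zer_sum (fun y => A1 y + A2 y) B !=set0 ->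
  0 < theta < 1 -> 0 < delta < 1 -> 0 < deltabar -> 0 < 1 - delta - deltabar ->
  0 < a 0 -> a 0 <= 4 * beta * deltabar ->
  (* line search: j(k) is the smallest j satisfying the test *)
  (let xbj k j := resolvent B (a k * theta ^+ j)
                    (x k - (a k * theta ^+ j) *: (A1 (x k) + A2 (x k))) in
   let test k j := a k * theta ^+ j * ip (A2 (x k) - A2 (xbj k j)) (x k - xbj k j)
                   <= delta * `|x k - xbj k j| ^+ 2 in
   forall k, test k (jj k) /\ forall j, (j < jj k)%N -> ~ test k j) ->
  (forall k, a k.+1 = a k * theta ^+ jj k) ->
  (forall k, xb k = resolvent B (a k.+1) (x k - a k.+1 *: (A1 (x k) + A2 (x k)))) ->
  (forall k, x k.+1 = proj_onto
     [set y | (ip ((a k.+1)^-1 *: (x k - xb k) - (A2 (x k) - A2 (xb k))) (y - xb k)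
              <= deltabar / a k.+1 * `|x k - xb k| ^+ 2)%R] (x k)) ->
  (* Method 1 does not stop *)
  (forall k, x k.+1 <> x k) ->
  forall z, weak_cluster ip x z -> zer_sum (fun y => A1 y + A2 y) B z.
Proof.
move=> ipi beta0 coco maxA2 ucA2 maxB [s0 [b0 Bs0 s0_zero]] theta01 delta01 db0.
move=> kappa0 a00 a0_le search aS xbE xS nonstop z zcl.
have de0 : 0 < delta by case/andP: delta01.
have th0 : 0 < theta by case/andP: theta01.
have a_gt0 := step_gt0 theta01 a00 aS.
pose al k := a k.+1; pose ds k := x k - xb k.
pose gap k := A2 (x k) - A2 (xb k).
pose v k := (al k)^-1 *: ds k - gap k.
have al_gt0 k : 0 < al k := a_gt0 k.+1.
have al_le k : al k <= 4 * beta * deltabar.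
  exact: le_trans (step_nonincreasing theta01 a00 aS (leq0n k.+1)) a0_le.
have monoA2 p q : 0 <= ip (A2 p - A2 q) (p - q).
  by rewrite ipC//; apply: (proj1 maxA2).
have Bxb k : B (xb k) ((al k)^-1 *: ds k - (A1 (x k) + A2 (x k))).
  by rewrite /ds xbE; exact: (resolvent_forward ipi (x k) _ maxB (al_gt0 k)).
have test k : al k * ip (gap k) (ds k) <= delta * `|ds k| ^+ 2.
  by have [+ _] := search k; rewrite -aS -xbE.
have ds0 := ds_to0 ipi beta0 coco monoA2 (proj1 maxB) db0 kappa0
  al_gt0 al_le Bxb test xS nonstop ucA2 Bs0 s0_zero.
have gap0 := gap_to0 ipi beta0 coco monoA2 (proj1 maxB) db0 kappa0
  al_gt0 al_le Bxb test xS nonstop ucA2 Bs0 s0_zero.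
have slow_of (eta : R) k : `|ds k| < eta / 2 * al k -> `|gap k| < eta / 2 ->
    `|v k| < eta.
  move=> h1 h2; apply: le_lt_trans (ler_normB _ _) _.
  rewrite normrZ gtr0_norm ?invr_gt0// (splitr eta) ltrD//.
  by rewrite mulrC ltr_pdivrMr.
have [slow fast] : (forall (eta : R) N, 0 < eta ->
      exists2 s, (N <= s)%N & `|v s| < eta) /\
    (forall eta : R, 0 < eta -> \forall k \near \oo,
      eta <= `|v k.+1| -> al k.+1 = al k).
  (* If backtracking ends, the step size is eventually constant and [v k] tends to [0] with [ds k].
     Otherwise the step sizes tend to [0] and the backtracking indices are the slow ones. *)
  have [[N0 jj0]|often] := pselect (exists N, forall k, (N <= k)%N -> jj k = 0%N).
    split=> eta; last first.
      move=> _; exists N0 => // k /= N0k _.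
      by rewrite /al aS jj0 ?mulr1// (leq_trans N0k)// -addn2 leq_addr.
    move=> N eta0; have eta2 : 0 < eta / 2 by rewrite divr_gt0.
    have al_cst i : al (N0 + i)%N = al N0.
      elim: i => [|i IH]; first by rewrite addn0.
      rewrite -IH /al addnS (aS (N0 + i).+1%N) jj0 ?mulr1//.
      by rewrite -addnS leq_addr.
    have [N1 _ hN1] := filterI (ds0 _ (mulr_gt0 eta2 (al_gt0 N0))) (gap0 _ eta2).
    exists (N0 + maxn N N1)%N.
      by rewrite (leq_trans (leq_maxl N N1))// leq_addl.
    have [] := hN1 (N0 + maxn N N1)%N.
      by rewrite /= (leq_trans (leq_maxr N N1))// leq_addl.
    by move=> h1 h2; apply: slow_of; rewrite ?al_cst.
  have inf N : exists2 k, (N <= k)%N & (0 < jj k)%N.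
    apply: contrapT => none; apply: often; exists N => k Nk.
    by apply/eqP; rewrite -leqn0 leqNgt; apply/negP => jk; apply: none; exists k.
  have backtracked (eta : R) : 0 < eta ->
      \forall k \near \oo, (0 < jj k)%N -> `|v k| < eta.
    move=> eta0; have eta2 : 0 < eta / 2 by rewrite divr_gt0.
    have [r r0 disp] :=
      backtracking_displacement ipi ucA2 maxB theta01 de0 eta2.
    apply: (filterS _ (filterI (step_to0 theta01 a00 aS inf r0) (gap0 _ eta2))).
    move=> k [akr gapk] jk; apply: slow_of => //.
    (* By minimality of [jj k] the preceding trial step failed the test, and [al k] is [theta] times
       that trial step. *)
    have [_ /(_ (jj k).-1)] := search k; rewrite prednK// => /(_ (leqnn _)).
    move=> /negP; rewrite -ltNge => failed.
    have alE : al k = a k * theta ^+ (jj k).-1 * theta.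
      by rewrite -mulrA -exprSr prednK// /al aS.
    have := disp _ _ _ _ failed; rewrite -alE /ds xbE; apply.
    rewrite mulr_gt0 ?exprn_gt0//=; apply: le_lt_trans akr.
    rewrite ger_pMr//; apply: exprn_ile1; first exact: ltW.
    by case/andP: theta01 => _ /ltW.
  split=> eta.
    move=> N eta0; have [N1 _ hN1] := backtracked _ eta0.
    have [k Nk jk] := inf (maxn N N1); exists k.
      exact: leq_trans (leq_maxl _ _) Nk.
    by apply: hN1 => //=; exact: leq_trans (leq_maxr _ _) Nk.
  move=> /backtracked[N1 _ hN1]; exists N1 => // k /= N1k fastk.
  have : ~~ (0 < jj k.+1)%N.
    apply/negP => /(hN1 _ (leqW N1k)).
    by rewrite ltNge fastk.
  by rewrite -eqn0Ngt /al (aS k.+1) => /eqP ->; rewrite mulr1.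
apply: (zer_sum_of_variational ipi maxB) => [e e0|y b Byb].
  have [d d0 hd] := ucA2 _ (divr_gt0 e0 (ltr0n _ 2)).
  exists (Num.min d (e / 2 * beta)); first by rewrite lt_min d0 mulr_gt0// divr_gt0.
  move=> p q; rewrite lt_min => /andP[pq1 pq2].
  rewrite opprD addrACA (splitr e); apply: le_lt_trans (ler_normD _ _) _.
  apply: ltrD; last exact: hd.
  apply: le_lt_trans (cocoercive_lipschitz ipi beta0 coco p q) _.
  by rewrite mulrC ltr_pdivrMr.
apply/ler_addgt0Pr => e e0; rewrite add0r; apply: (weak_cluster_le ipi zcl).
exact: (limsup_graph ipi beta0 coco monoA2 (proj1 maxB) delta01 db0 kappa0
  al_gt0 al_le Bxb test xS nonstop ucA2 Bs0 s0_zero slow fast Byb e0).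
Qed.
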